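(* Let $m>1$ and $n\ge1$ be integers, let $f=(f_1,\dots,f_n):\mathbb{R}^m\to\mathbb{R}^n$ be differentiable, let $j\in\{1,\dots,n\}$, and let $x\in\mathbb{R}^m$ be such that $f_j(x)\ne0$ and $\mathrm{WCC}_j(x)>0$. Put $$\varepsilon_m=\frac{2+2\ln m}{\sqrt{m-1}}.$$ Then $$-\frac{\log(m-1)}{2}-\frac{\log 3}{2}-(1+\varepsilon_m)\log e<\mathrm{SCLP}_j(x)-\log\mathrm{WCC}_j(x)\le-1$$ and $$\frac{e^{-(1+\varepsilon_m)}}{\sqrt{3(m-1)}}<\frac{\mathrm{SCC}_j(x)}{\mathrm{WCC}_j(x)}\le\frac12.$$
   Context: A computational problem with input $x\in\mathbb{R}^m$ and output in $\mathbb{R}^n$ is given by a differentiable function $f:\mathbb{R}^m\to\mathbb{R}^n$; $f_j$ is its $j$-th component. $\log$ is the logarithm with base $2$, $\ln$ is the natural logarithm, and $e$ is its base. For $\delta>0$ let $CP(x,\delta)=\{x'\in\mathbb{R}^m: |x'_i-x_i|\le\delta|x_i| \text{ for } i=1,\dots,m\}$. The notation $x'\sim CP(x,\delta)$ means that $x'$ is uniformly distributed in $CP(x,\delta)$, i.e. its coordinates $x_i'$ are independent and uniform on $[x_i-\delta|x_i|,x_i+\delta|x_i|]$ (with $x_i'=x_i$ if $x_i=0$), and $\mathbb{E}_{x'\sim CP(x,\delta)}$ is the corresponding expectation. All limits are for $\delta\to0$, $\delta>0$. Worst-case component-wise condition number: $$\mathrm{WCC}_j(x)=\lim_{\delta\to0}\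 \sup_{x'\in CP(x,\delta)}\frac{|f_j(x')-f_j(x)|}{\delta|f_j(x)|}.$$ Stochastic component-wise condition number: $$\mathrm{SCC}_j(x)=\lim_{\delta\to0}\ \mathbb{E}_{x'\sim CP(x,\delta)}\frac{|f_j(x')-f_j(x)|}{\delta|f_j(x)|}.$$ Stochastic component-wise loss of precision: $$\mathrm{SCLP}_j(x)=\lim_{\delta\to0}\ \mathbb{E}_{x'\sim CP(x,\delta)}\log\frac{|f_j(x')-f_j(x)|}{\delta|f_j(x)|}.$$
   Formalization: The lower bound on SCLP_j(x) − log WCC_j(x) is false for merely differentiable f; it is proved assuming the partial derivatives of f_j are continuous at x (then the SCLP limit exists). The upper bound −1 is proved whenever the limit defining SCLP_j(x) exists. *)

(* Defs.v *)
From HB Require Import structures.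
From mathcomp Require Import all_boot all_order all_algebra.
From mathcomp Require Import all_classical all_reals all_analysis.

Set Implicit Arguments.
Unset Strict Implicit.
Unset Printing Implicit Defensive.

Import Order.TTheory GRing.Theory Num.Theory.
Import numFieldNormedType.Exports.

Local Open Scope classical_set_scope.
Local Open Scope ring_scope.

Section Log2.
Context {R : realType}.

Definition log2 (r : R) : R := ln r / ln 2.

(* [elog2 0 = -oo], whereas the totalised [log2 0] is [0]. *)
Definition elog2 (u : \bar R) : \bar R := (lne u * (ln 2)^-1%:E)%E.

End Log2.

Section ProductLaw.
Context {R : realType}.

Definition cons_pair n (p : measurableTypeR R * n.-tuple (measurableTypeR R)) :
  n.+1.-tuple (measurableTypeR R) := [tuple of p.1 :: p.2].

Lemma measurable_cons_pair n : measurable_fun [set: _] (@cons_pair n).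
Proof. exact: measurable_cons. Qed.

HB.instance Definition _ n := isMeasurableFun.Build _ _ _ _
  (@cons_pair n) (@measurable_cons_pair n).

(* The law of a tuple of independent real random variables with laws P i. *)
Fixpoint product_law n : ('I_n -> probability (measurableTypeR R) R) ->
    probability (n.-tuple (measurableTypeR R)) R :=
  match n with
  | 0 => fun _ => \d_[tuple]
  | n'.+1 => fun P =>
      distribution (P ord0 \x product_law (fun i => P (lift ord0 i)))%E
        (@cons_pair n')
  end.

(* Uniform on [a, b]; the point mass at a when the interval is degenerate. *)
Definition uniform_law (a b : R) : probability (measurableTypeR R) R :=
  match @idP (a < b) with
  | ReflectT ab => uniform_prob ab
  | ReflectF _ => \d_(a : measurableTypeR R)
  end.

End ProductLaw.

Section ComponentwisePerturbation.
Context {R : realType} {m : nat}.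

Definition CP (x : 'rV[R]_m) (delta : R) : set 'rV[R]_m :=
  [set x' | forall i, `|x' 0 i - x 0 i| <= delta * `|x 0 i|].

Definition CP_law (x : 'rV[R]_m) (delta : R) :
    probability (m.-tuple (measurableTypeR R)) R :=
  product_law (fun i => uniform_law (x 0 i - delta * `|x 0 i|)
                                    (x 0 i + delta * `|x 0 i|)).

Definition CP_expectation (x : 'rV[R]_m) (delta : R)
    (g : 'rV[R]_m -> \bar R) : \bar R :=
  (\int[CP_law x delta]_t g (\row_i tnth t i))%E.

End ComponentwisePerturbation.

Section ConditionNumbers.
Context {R : realType} {m n : nat}.
Variables (f : 'rV[R]_m -> 'rV[R]_n) (j : 'I_n) (x : 'rV[R]_m).

Definition error_ratio (delta : R) (x' : 'rV[R]_m) : R :=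
  `|f x' 0 j - f x 0 j| / (delta * `|f x 0 j|).

Definition WCC_at (delta : R) : \bar R :=
  ereal_sup [set (error_ratio delta x')%:E | x' in CP x delta].

Definition SCC_at (delta : R) : \bar R :=
  CP_expectation x delta (fun x' => (error_ratio delta x')%:E).

Definition SCLP_at (delta : R) : \bar R :=
  CP_expectation x delta (fun x' => elog2 (error_ratio delta x')%:E).

Definition WCC : \bar R := lim (WCC_at delta @[delta --> 0^'+]).
Definition SCC : \bar R := lim (SCC_at delta @[delta --> 0^'+]).
Definition SCLP : \bar R := lim (SCLP_at delta @[delta --> 0^'+]).

End ConditionNumbers.

Definition epsilon (R : realType) (m : nat) : R :=
  (2 + 2 * ln m%:R) / Num.sqrt (m%:R - 1).

(* Main.v *)
Require Import Defs.
From mathcomp Require Import all_boot all_order all_algebra.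
From mathcomp Require Import all_classical all_reals all_analysis.
From mathcomp Require Import measurable_realfun ring lra.

Set Implicit Arguments.
Unset Strict Implicit.
Unset Printing Implicit Defensive.

Import Order.TTheory GRing.Theory Num.Theory.
Import numFieldNormedType.Exports.

Local Open Scope classical_set_scope.
Local Open Scope ring_scope.

(** Let g be the j-th component of f, put w_i = (d_i g)(x) |x_i| / |g(x)|,
    W = sum_i |w_i| and V = sum_i w_i^2.  After the box around x is rescaled
    to the cube [-1, 1]^m, the relative error divided by delta converges,
    uniformly on the cube, to |S| with S(t) = sum_i w_i t_i ([ratio_approx]),
    and the coordinates t_i are independent and uniform on [-1, 1].  So the
    worst case tends to the maximum W of |S|, the mean tends to E|S|, and,
    when singularities are under control, the mean logarithm tends to
    E log |S|.

    Upper bounds.  E|S| <= sum_i |w_i| E|t_i| = W / 2, and replacing the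
    logarithm by its tangent at W / 2 turns this into a bound on the mean
    logarithm ([SCLP_at_le]).

    Lower bounds.  Everything follows from
      E ln |S| >= 1/2 ln (V / 3) - 1    ([mean_log_ge]):
    by Cauchy-Schwarz V >= W^2 / m, replacing m by m - 1 costs less than
    epsilon_m, and Jensen's inequality passes from E ln |S| to ln E|S|.

    This inequality is three-dimensional.  By Archimedes, a uniform variable on
    [-1, 1] is a coordinate of a uniform point of the unit sphere of R^3, so
    that S has the law of |Xi| u, where Xi is the end point of a walk in R^3
    with independent isotropic steps of lengths |w_i| and u is uniform on
    [-1, 1] and independent of Xi.  Hence E ln |S| = E ln |Xi| + E ln |u|
    = E ln |Xi| - 1.  A step of length |w| from a point at distance r of the
    origin leads to squared distance r^2 + w^2 + 2 r w y with y uniform, and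
    one such step satisfies
      E ln (c + r^2 + w^2 + 2 r w y) >= ln (c + r^2 + w^2 / 3)  ([log_step]),
    which by induction gives E ln (c + |Xi|^2) >= ln (c + V / 3).
    In place of spheres, the proof uses the radial function
    F(r) = 1/2 ln (1 + r^2) and [pot] = (r F(r))': F(r) is the mean of
    [pot (r u)], and the compatibility of this mean with random steps is an
    identity between integrals over intervals ([archimedes]).  The
    constant 1 under the logarithm removes the singularity, and the scaling
    S / tau^2 with tau -> 0 restores it ([pot_le_ln]).

    The singularity of the logarithm at 0 is controlled by the mean of
    |phi|^(-1/2): this mean is bounded as soon as phi increases or decreases
    with slope at least k along one coordinate ([mean_inv_sqrt_le]).  For S
    this holds along each coordinate with w_i != 0; for the error itself it
    holds for small delta when the partial derivatives are continuous at x,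
    and this gives the uniform integrability behind the convergence of the mean
    logarithm ([cvg_SCLP_at]). *)

(** * Differentiation and continuity of explicit real functions *)
Section PointwiseDerivatives.
Context {R : realType}.
Implicit Types (f g : R -> R) (x a b : R).

(** These rules differentiate functions written pointwise, with multiplication
    in place of scaling, so that they compose as terms. *)
Lemma is_derive_add f g x a b : is_derive x 1 f a -> is_derive x 1 g b ->
  is_derive x 1 (fun y => f y + g y) (a + b).
Proof. by move=> ? ?; exact: is_deriveD. Qed.

Lemma is_derive_sub f g x a b : is_derive x 1 f a -> is_derive x 1 g b ->
  is_derive x 1 (fun y => f y - g y) (a - b).
Proof. by move=> ? ?; exact: is_deriveB. Qed.

Lemma is_derive_mul f g x a b : is_derive x 1 f a -> is_derive x 1 g b ->
  is_derive x 1 (fun y => f y * g y) (f x * b + g x * a).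
Proof. by move=> ? ?; exact: is_deriveM. Qed.

Lemma is_derive_scale k f x a : is_derive x 1 f a ->
  is_derive x 1 (fun y => k * f y) (k * a).
Proof. by move=> ?; exact: is_deriveZ. Qed.

Lemma is_derive_exp n f x a : is_derive x 1 f a ->
  is_derive x 1 (fun y => f y ^+ n.+1) (n.+1%:R * f x ^+ n * a).
Proof.
move=> Df; have := is_deriveX n.+1 Df.
rewrite (_ : f ^+ n.+1 = fun y => f y ^+ n.+1) //.
by apply/funext => y; rewrite exprfctE.
Qed.

Lemma is_derive_comp f g x a b :
  is_derive x 1 f a -> is_derive (f x) 1 g b ->
  is_derive x 1 (fun y => g (f y)) (a * b).
Proof.
by move=> Df Dg; have := is_derive1_comp Dg Df; rewrite mulrC.
Qed.

Lemma is_derive_affine k c x : is_derive x 1 (fun y => c + k * y) k.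
Proof.
have := is_derive_add (is_derive_cst c x 1)
  (is_derive_scale k (is_derive_id x 1)).
by rewrite add0r mulr1.
Qed.

Lemma is_derive_continuous f x a : is_derive x 1 f a -> {for x, continuous f}.
Proof.
by move=> [/derivable1_diffP/differentiable_continuous].
Qed.

Lemma is_derive_shift c x : is_derive x 1 (fun u => c + u) 1.
Proof.
rewrite (_ : (fun u => c + u) = fun u => c + 1 * u); first exact: is_derive_affine.
by apply/funext => u; rewrite mul1r.
Qed.

Lemma is_derive_flip c x : is_derive x 1 (fun u => c - u) (-1).
Proof.
rewrite (_ : (fun u => c - u) = fun u => c + -1 * u); first exact: is_derive_affine.
by apply/funext => u; rewrite mulN1r.
Qed.

Lemma continuous_shift c : continuous (fun u : R => c + u).
Proof. by move=> x; exact: (is_derive_continuous (is_derive_shift c x)). Qed.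

Lemma continuous_affine k c : continuous (fun u : R => c + k * u).
Proof. by move=> x; exact: (is_derive_continuous (is_derive_affine k c x)). Qed.

End PointwiseDerivatives.

(** * The logarithmic potential *)
Lemma ln_1Dx_le (R : realType) (y : R) : 0 <= y -> ln (1 + y) <= y.
Proof. by move=> y0; apply: le_ln1Dx; lra. Qed.

Section LogPotential.
Context {R : realType}.
Implicit Types (z : R).

(** [pot2], [pot1] and [pot] are successive derivatives, and
    [pot1 r = r * F r] for the radial function [F r = ln (1 + r ^+ 2) / 2]. *)
Definition pot2 z : R := 4^-1 * ((1 + z ^+ 2) * ln (1 + z ^+ 2) - z ^+ 2).
Definition pot1 z : R := 2^-1 * (z * ln (1 + z ^+ 2)).
Definition pot z : R := 2^-1 * ln (1 + z ^+ 2) + z ^+ 2 / (1 + z ^+ 2).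

Let sq_gt0 z : 0 < 1 + z ^+ 2.
Proof. by rewrite ltr_wpDr// sqr_ge0. Qed.

Let D1 z : is_derive z 1 (fun y : R => 1 + y ^+ 2) (2 * z).
Proof.
have := is_derive_add (is_derive_cst (1 : R) z 1) (is_derive_exp 1 (is_derive_id z 1)).
by rewrite add0r expr1 mulr1.
Qed.

Let Dln z : is_derive z 1 (fun y : R => ln (1 + y ^+ 2)) (2 * z / (1 + z ^+ 2)).
Proof. by apply: (is_derive_comp (D1 z)); exact: is_derive1_ln. Qed.

Lemma is_derive_pot2 z : is_derive z 1 pot2 (pot1 z).
Proof.
apply: (is_derive_eq (is_derive_scale 4^-1 (is_derive_sub
  (is_derive_mul (D1 z) (Dln z)) (is_derive_exp 1 (is_derive_id z 1))))).
rewrite /pot1; field; by rewrite gt_eqF.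
Qed.

Lemma is_derive_pot1 z : is_derive z 1 pot1 (pot z).
Proof.
apply: (is_derive_eq (is_derive_scale 2^-1
  (is_derive_mul (is_derive_id z 1) (Dln z)))).
rewrite /pot; field; by rewrite gt_eqF.
Qed.

Lemma continuous_pot : continuous pot.
Proof.
move=> z; apply: cvgD.
  by apply: cvgM; [exact: cvg_cst|exact: (is_derive_continuous (Dln z))].
apply: cvgM; first exact: exprn_continuous.
apply: cvgV; first by rewrite gt_eqF.
exact: (is_derive_continuous (D1 z)).
Qed.

Lemma continuous_pot2 : continuous pot2.
Proof. by move=> z; exact: (is_derive_continuous (is_derive_pot2 z)). Qed.

Lemma continuous_pot1 : continuous pot1.
Proof. by move=> z; exact: (is_derive_continuous (is_derive_pot1 z)). Qed.

Lemma pot_ge0 z : 0 <= pot z.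
Proof.
apply: addr_ge0; last by rewrite divr_ge0 ?sqr_ge0// ltW.
by rewrite mulr_ge0 ?invr_ge0// ln_ge0// lerDl sqr_ge0.
Qed.

Lemma pot_le z : pot z <= z ^+ 2 + 1.
Proof.
have z2 := sqr_ge0 z.
have h := ln_1Dx_le z2.
have : z ^+ 2 / (1 + z ^+ 2) <= 1.
  by rewrite ler_pdivrMr ?mul1r; lra.
rewrite /pot; lra.
Qed.

Lemma pot1N z : pot1 (- z) = - pot1 z.
Proof. by rewrite /pot1 sqrrN mulNr mulrN. Qed.

End LogPotential.

(** * Means of a uniform variable on [-1, 1] *)
Section UniformLaw.
Context {R : realType}.
Local Notation mu := (@lebesgue_measure R).
Implicit Types (f g F G : R -> R).

Lemma uniform_lawE (a b : R) (ab : a < b) : uniform_law a b = uniform_prob ab.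
Proof.
rewrite /uniform_law; case: {-}_ / idP => [ab'|//].
by rewrite (bool_irrelevance ab' ab).
Qed.

Lemma ge0_integral_uniform_law (a b : R) (ab : a < b) (f : measurableTypeR R -> \bar R) :
  measurable_fun [set: measurableTypeR R] f -> (forall y, 0 <= f y)%E ->
  (\int[uniform_law a b]_y f y =
   (b - a)^-1%:E * \int[mu]_(y in `[a, b]) f y)%E.
Proof. by move=> mf f0; rewrite uniform_lawE integral_uniform. Qed.

Definition unif : probability (measurableTypeR R) R := uniform_law (-1) 1.

Lemma ge0_integral_unif (f : measurableTypeR R -> \bar R) :
  measurable_fun [set: measurableTypeR R] f -> (forall y, 0 <= f y)%E ->
  (\int[unif]_y f y = 2^-1%:E * \int[mu]_(y in `[(-1)%R, 1%R]) f y)%E.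
Proof.
move=> mf f0; have N11 : (-1 : R) < 1 by lra.
rewrite /unif ge0_integral_uniform_law//.
by rewrite opprK (_ : 1 + 1 = 2)//; lra.
Qed.

Lemma continuous_N11 f :
  (forall y : R, -1 <= y <= 1 -> {for y, continuous f}) ->
  {within `[-1, 1], continuous f}.
Proof.
move=> cf; apply: continuous_in_subspaceT => y.
by rewrite inE/= in_itv/=; exact: cf.
Qed.

Lemma FTC_N11 f F : (forall y : R, -1 <= y <= 1 -> {for y, continuous f}) ->
  continuous F ->
  (forall y : R, -1 < y < 1 -> is_derive y 1 F (f y)) ->
  (\int[mu]_(y in `[(-1)%R, 1%R]) (f y)%:E = (F 1 - F (-1))%:E)%E.
Proof.
move=> cf cF dF; rewrite (@continuous_FTC2 _ f F)//.
- exact: continuous_N11.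
- split; first by move=> y; rewrite in_itv/= => /dF[].
  + by apply: cvg_at_right_filter; exact: cF.
  + by apply: cvg_at_left_filter; exact: cF.
- by move=> y; rewrite in_itv/= => /dF ?; rewrite derive1E derive_val.
Qed.

(** The derivative is only required inside the interval because the length
    of a random walk is not differentiable where it vanishes. *)
Lemma FTC_unif f F : continuous f -> (forall y, 0 <= f y) -> continuous F ->
  (forall y : R, -1 < y < 1 -> is_derive y 1 F (f y)) ->
  (\int[unif]_y (f y)%:E = ((F 1 - F (-1)) / 2)%:E)%E.
Proof.
move=> cf f0 cF dF; rewrite ge0_integral_unif//.
- rewrite (FTC_N11 (fun y _ => cf y) cF dF) -EFinM mulrC.
  by [].
- apply/measurable_EFinP; exact: continuous_measurable_fun.
Qed.

Lemma FTC_unif_ge f g G : continuous f -> (forall y, 0 <= f y) ->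
  (forall y : R, -1 <= y <= 1 -> {for y, continuous g}) -> continuous G ->
  (forall y : R, -1 < y < 1 -> is_derive y 1 G (g y)) ->
  (forall y : R, -1 <= y <= 1 -> g y <= f y) ->
  (((G 1 - G (-1)) / 2)%:E <= \int[unif]_y (f y)%:E)%E.
Proof.
move=> cf f0 cg cG dG gf; rewrite ge0_integral_unif//; last first.
  by apply/measurable_EFinP; exact: continuous_measurable_fun.
rewrite mulrC EFinM -(FTC_N11 cg cG dG) lee_wpmul2l ?lee_fin ?invr_ge0//.
apply: le_integral => //.
- apply: continuous_compact_integrable; first exact: segment_compact.
  exact: continuous_N11.
- apply: continuous_compact_integrable; first exact: segment_compact.
  exact: continuous_subspaceT.
- by move=> y; rewrite inE/= in_itv/= => /gf; rewrite lee_fin.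
Qed.

End UniformLaw.

(** * Archimedes' theorem and random steps in space *)
Section Archimedes.
Context {R : realType}.
Implicit Types (r w c t y s : R).

(** By Archimedes, the mean of [pot] of the first coordinate over a sphere in
    R^3 of radius [r], centered at [(t, 0, 0)]. *)
Definition mean_pot r t : R :=
  if r == 0 then pot t else (pot1 (t + r) - pot1 (t - r)) / (2 * r).

Lemma mean_potE r t :
  (\int[unif]_y (pot (t + r * y))%:E = (mean_pot r t)%:E)%E.
Proof.
rewrite /mean_pot; case: eqVneq => [->|r0].
  under eq_integral do rewrite mul0r addr0.
  by rewrite integral_cst// [X in (_ * X)%E]probability_setT mule1.
have Dp y : is_derive y 1 (fun u : R => r^-1 * pot1 (t + r * u)) (pot (t + r * y)).
  apply: (is_derive_eq (is_derive_scale r^-1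
    (is_derive_comp (is_derive_affine r t y) (is_derive_pot1 _)))).
  by rewrite mulKf.
rewrite (@FTC_unif _ _ (fun u : R => r^-1 * pot1 (t + r * u))).
- congr EFin; rewrite mulr1 mulrN1; field; exact: r0.
- move=> y; apply: (@continuous_comp _ _ _ (fun u => t + r * u) pot).
    exact: (is_derive_continuous (is_derive_affine r t y)).
  exact: continuous_pot.
- by move=> y; exact: pot_ge0.
- by move=> y; exact: (is_derive_continuous (Dp y)).
Qed.

Lemma mean_pot_ge0 r t : 0 <= mean_pot r t.
Proof.
rewrite -lee_fin -mean_potE; apply: integral_ge0 => y _.
by rewrite lee_fin pot_ge0.
Qed.

Lemma mean_potN r t : mean_pot (- r) t = mean_pot r t.
Proof.
rewrite /mean_pot oppr_eq0; case: eqVneq => // r0.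
rewrite opprK; field; exact: r0.
Qed.

Lemma mean_pot_norm r t : mean_pot `|r| t = mean_pot r t.
Proof. by case: (ger0P r) => // _; exact: mean_potN. Qed.

Let Dpair r t : is_derive r 1 (fun u : R => pot1 (t + u) - pot1 (t - u))
  (pot (t + r) + pot (t - r)).
Proof.
apply: (is_derive_eq (is_derive_sub
  (is_derive_comp (is_derive_shift t r) (is_derive_pot1 _))
  (is_derive_comp (is_derive_flip t r) (is_derive_pot1 _)))).
by rewrite mul1r mulN1r opprK.
Qed.

(** At [r = 0] the difference quotient tends to the derivative of [pot1]. *)
Lemma continuous_mean_pot t : continuous (mean_pot ^~ t).
Proof.
move=> r; have [r0|r0] := eqVneq r 0.
  have /is_derive1_caratheodory[g [gE cg g0]] := Dpair r t.
  rewrite r0 in gE cg g0 *.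
  suff -> : mean_pot ^~ t = fun u => 2^-1 * g u.
    by apply: cvgM; [exact: cvg_cst|exact: cg].
  apply/funext => u; rewrite /mean_pot; case: eqVneq => [->|u0].
    by rewrite g0 addr0 subr0; field.
  have := gE u; rewrite addr0 !subr0 subrr subr0 => ->.
  by field.
have cD := is_derive_continuous (Dpair r t).
rewrite /continuous_at {2}/mean_pot (negbTE r0).
have : (fun u => (pot1 (t + u) - pot1 (t - u)) / (2 * u)) @ r -->
    (pot1 (t + r) - pot1 (t - r)) / (2 * r).
  apply: cvgM; first exact: cD.
  apply: cvgV; first by rewrite mulf_neq0.
  by apply: cvgM; [exact: cvg_cst|exact: cvg_id].
apply: cvg_trans; apply: near_eq_cvg; near=> u.
rewrite /mean_pot ifF//; apply/negbTE.
near: u; apply: cvgr_neq0 r0; exact: cvg_id.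
Unshelve. all: by end_near. Qed.

End Archimedes.

Section RandomStep.
Context {R : realType}.
Implicit Types (r w c t y s : R).

(** Squared distance to the origin after a step of length [w] from distance
    [r], when [y] is the cosine of the angle between position and step. *)
Definition step_sq r w y : R := r ^+ 2 + w ^+ 2 + (2 * r * w) * y.

Lemma step_sq_ge r w y : -1 <= y <= 1 -> (`|r| - `|w|) ^+ 2 <= step_sq r w y.
Proof.
move=> /andP[y1 y2]; rewrite /step_sq sqrrB !real_normK ?num_real//.
have : `|r * w * y| <= `|r| * `|w|.
  by rewrite !normrM ler_piMr ?mulr_ge0// ler_norml y1.
rewrite ler_norml => /andP[+ _]; rewrite mulr2n; lra.
Qed.

Lemma step_sq_gt0 r w y : r != 0 -> w != 0 -> -1 < y < 1 -> 0 < step_sq r w y.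
Proof.
move=> r0 w0 /andP[y1 y2].
have rw0 : 0 < `|r| * `|w| by rewrite mulr_gt0 ?normr_gt0.
have : `|r * w * y| < `|r| * `|w|.
  by rewrite !normrM gtr_pMr// ltr_norml y1.
rewrite ltr_norml => /andP[+ _].
have := sqr_ge0 (`|r| - `|w|); rewrite sqrrB !real_normK ?num_real//.
rewrite /step_sq mulr2n; lra.
Qed.

Lemma is_derive_step_sq r w y : is_derive y 1 (step_sq r w) (2 * r * w).
Proof. exact: is_derive_affine. Qed.

Lemma continuous_step_sq r w : continuous (step_sq r w).
Proof. by move=> y; exact: (is_derive_continuous (is_derive_step_sq r w y)). Qed.

Lemma continuous_sqrt_step r w : continuous (fun y => Num.sqrt (step_sq r w y)).
Proof.
move=> y; apply: (@continuous_comp _ _ _ (step_sq r w) Num.sqrt).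
  exact: continuous_step_sq.
exact: sqrt_continuous.
Qed.

Lemma is_derive_sqrt_step r w y : 0 < step_sq r w y ->
  is_derive y 1 (fun u => Num.sqrt (step_sq r w u))
    (r * w / Num.sqrt (step_sq r w y)).
Proof.
move=> s0.
apply: (is_derive_eq (is_derive_comp (is_derive_step_sq r w y)
   (is_derive1_sqrt s0))).
field; by rewrite gt_eqF// sqrtr_gt0.
Qed.

Lemma sqrt_step1 r w : Num.sqrt (step_sq r w 1) = `|r + w|.
Proof. by rewrite -sqrtr_sqr; congr Num.sqrt; rewrite /step_sq; ring. Qed.

Lemma sqrt_stepN1 r w : Num.sqrt (step_sq r w (-1)) = `|r - w|.
Proof. by rewrite -sqrtr_sqr; congr Num.sqrt; rewrite /step_sq; ring. Qed.

Lemma pot2_norm_pair t a :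
  pot2 (t + `|a|) + pot2 (t - `|a|) = pot2 (t + a) + pot2 (t - a).
Proof. by case: (ger0P a) => // _; rewrite opprK addrC. Qed.

(** Both sides are second differences of [pot2]: the left one on the grid
    [t +/- r +/- w]; on the right, the derivative in [y] of
    [pot2 (t + s) + pot2 (t - s)], where [s] is the new distance, is
    [(pot1 (t + s) - pot1 (t - s)) * r * w / s], and [s] runs from
    [`|r - w|] to [`|r + w|]. *)
Lemma archimedes_step r w t : r != 0 -> w != 0 ->
  (\int[unif]_y (mean_pot r (t + w * y))%:E =
   \int[unif]_y (mean_pot (Num.sqrt (step_sq r w y)) t)%:E)%E.
Proof.
move=> r0 w0.
pose k := (2 * r * w)^-1.
pose F1 y := k * (pot2 (t + r + w * y) - pot2 (t - r + w * y)).
pose F2 y := k * (pot2 (t + Num.sqrt (step_sq r w y)) +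
                  pot2 (t - Num.sqrt (step_sq r w y))).
have D1 y : is_derive y 1 F1 (mean_pot r (t + w * y)).
  apply: (is_derive_eq (is_derive_scale k (is_derive_sub
    (is_derive_comp (is_derive_affine w (t + r) y) (is_derive_pot2 _))
    (is_derive_comp (is_derive_affine w (t - r) y) (is_derive_pot2 _))))).
  rewrite /mean_pot (negbTE r0) /k.
  rewrite (addrAC t r) (addrAC t (- r)).
  field; by rewrite r0.
have D2 y : -1 < y < 1 ->
    is_derive y 1 F2 (mean_pot (Num.sqrt (step_sq r w y)) t).
  move=> /(step_sq_gt0 r0 w0) s0.
  have Ds := is_derive_sqrt_step s0.
  have s0' : Num.sqrt (step_sq r w y) != 0 by rewrite gt_eqF// sqrtr_gt0.
  apply: (is_derive_eq (is_derive_scale k (is_derive_add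
    (is_derive_comp Ds (is_derive_comp (is_derive_shift t _) (is_derive_pot2 _)))
    (is_derive_comp Ds (is_derive_comp (is_derive_flip t _) (is_derive_pot2 _)))))).
  rewrite /mean_pot (negbTE s0') /k.
  field; by rewrite ?s0' ?r0 ?w0.
have FE : F1 1 - F1 (-1) = F2 1 - F2 (-1).
  rewrite /F1 /F2 sqrt_step1 sqrt_stepN1 !pot2_norm_pair mulr1 mulrN1.
  rewrite !opprD !opprK !addrA.
  ring.
have cmean : continuous (mean_pot r).
  rewrite (_ : mean_pot r = fun u => (pot1 (r + u) - pot1 (- r + u)) / (2 * r)).
    move=> u; apply: cvgM; last exact: cvg_cst.
    by apply: cvgB; (apply: continuous_comp; first exact: continuous_shift);
      exact: continuous_pot1.
  by apply/funext => u; rewrite /mean_pot (negbTE r0) (addrC r) (addrC (- r)).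
have cF2 : continuous F2.
  have cs := @continuous_sqrt_step r w.
  move=> y; apply: cvgM; first exact: cvg_cst.
  apply: cvgD.
    apply: (@continuous_comp _ _ _ (fun u => t + Num.sqrt (step_sq r w u)) pot2).
      by apply: cvgD; [exact: cvg_cst|exact: cs].
    exact: continuous_pot2.
  apply: (@continuous_comp _ _ _ (fun u => t - Num.sqrt (step_sq r w u)) pot2).
    by apply: cvgB; [exact: cvg_cst|exact: cs].
  exact: continuous_pot2.
rewrite (@FTC_unif _ _ F1) ?FE; last 3 first.
- move=> y; apply: (@continuous_comp _ _ _ (fun u => t + w * u) (mean_pot r)).
    exact: continuous_affine.
  exact: cmean.
- by move=> y; exact: mean_pot_ge0.
- by move=> y; exact: (is_derive_continuous (D1 y)).
rewrite (@FTC_unif _ _ F2)//.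
- move=> y; apply: (@continuous_comp _ _ _ (fun u => Num.sqrt (step_sq r w u))
    (mean_pot ^~ t)).
    exact: continuous_sqrt_step.
  exact: continuous_mean_pot.
- by move=> y; exact: mean_pot_ge0.
Qed.

(** A point on a sphere of radius [r] plus an independent isotropic step of
    length [w] is isotropic, at the distance [Num.sqrt (step_sq r w y)] with
    [y] uniform. *)
Lemma archimedes r w t :
  (\int[unif]_y (mean_pot r (t + w * y))%:E =
   \int[unif]_y (mean_pot (Num.sqrt (step_sq r w y)) t)%:E)%E.
Proof.
have [->|r0] := eqVneq r 0.
  transitivity (\int[unif]_y (pot (t + w * y))%:E)%E.
    by apply: eq_integral => y _; rewrite /mean_pot eqxx.
  rewrite mean_potE.
  under eq_integral do
    rewrite /step_sq expr0n mulr0 !mul0r add0r addr0 sqrtr_sqr mean_pot_norm.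
  by rewrite integral_cst// [X in (_ * X)%E]probability_setT mule1.
have [->|w0] := eqVneq w 0; last exact: archimedes_step.
apply: eq_integral => y _.
by rewrite /step_sq expr0n mulr0 !mul0r !addr0 sqrtr_sqr mean_pot_norm.
Qed.

(** Dividing by [s] the Taylor inequality
    [s ln s >= (s - 1) + (s - 1)^2 / 2 - (s - 1)^3 / 6].  The mean of the right
    side over the distance [s] after a random step is explicit. *)
Lemma ln_lower_bound s : 0 < s ->
  - (s ^+ 2 / 6) + s - 2^-1 - (3 * s)^-1 <= ln s.
Proof.
move=> s0.
pose k (u : R) := ln u + 6^-1 * u ^+ 2 - u + 3^-1 * u^-1.
have Dk (u : R) : 0 < u -> is_derive u 1 k ((u - 1) ^+ 3 / (3 * u ^+ 2)).
  move=> u0; have u0' : u != 0 by rewrite gt_eqF.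
  apply: (is_derive_eq (is_derive_add (is_derive_sub (is_derive_add
    (is_derive1_ln u0) (is_derive_scale 6^-1 (is_derive_exp 1 (is_derive_id u 1))))
    (is_derive_id u 1)) (is_derive_scale 3^-1 (is_deriveV u0' (is_derive_id u 1))))).
  rewrite /GRing.scale/= expr1; field; exact: u0'.
have ck (a b : R) : 0 < a -> {within `[a, b], continuous k}.
  move=> a0; apply: continuous_in_subspaceT => u.
  rewrite inE/= in_itv/= => /andP[au _].
  exact: (is_derive_continuous (Dk _ (lt_le_trans a0 au))).
have k1 : k 1 = - 2^-1.
  by rewrite /k ln1 expr1n invr1; lra.
suff : k 1 <= k s by rewrite k1 /k invfM; lra.
have [s1|s1] := leP s 1.
  have [||u] := @MVT_segment R k (fun u => (u - 1) ^+ 3 / (3 * u ^+ 2)) s 1 s1.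
  - by move=> u; rewrite in_itv/= => /andP[su _]; apply: Dk; exact: lt_trans su.
  - exact: ck.
  - rewrite in_itv/= => /andP[su u1] E.
    rewrite -subr_le0 E; apply: mulr_le0_ge0; last by rewrite subr_ge0.
    apply: mulr_le0_ge0; last by rewrite invr_ge0 mulr_ge0 ?sqr_ge0.
    by rewrite exprS; apply: mulr_le0_ge0; rewrite ?sqr_ge0// subr_le0.
have [||u] := @MVT_segment R k (fun u => (u - 1) ^+ 3 / (3 * u ^+ 2)) 1 s (ltW s1).
- by move=> u; rewrite in_itv/= => /andP[su _]; apply: Dk; exact: lt_trans su.
- exact: ck.
- rewrite in_itv/= => /andP[u1 us] E.
  rewrite -subr_ge0 E; apply: mulr_ge0; last by rewrite subr_ge0 ltW.
  apply: mulr_ge0; last by rewrite invr_ge0 mulr_ge0 ?sqr_ge0.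
  by rewrite exprn_ge0// subr_ge0.
Qed.

End RandomStep.

(** * Growth of the logarithm under a random step *)
Section LogStep.
Context {R : realType}.
Implicit Types (r w c t y s : R).

Let cln c s : 1 <= c -> {for s, continuous (fun u : R => 2^-1 * ln (c + u ^+ 2))}.
Proof.
move=> c1; have p : 0 < c + s ^+ 2.
  by apply: ltr_wpDr; rewrite ?sqr_ge0// (lt_le_trans ltr01).
have D1 := is_derive_add (is_derive_cst (c : R) s 1) (is_derive_exp 1 (is_derive_id s 1)).
have D2 := is_derive_scale 2^-1 (is_derive_comp D1 (is_derive1_ln p)).
exact: (is_derive_continuous D2).
Qed.

(** Write [c + step_sq r w y] as [rho^2 + d^2 + 2 rho d y], which is again the
    squared distance after a step, now from [rho] with step [d], and
    [d^2 <= w^2].  Bounding [ln (s / rho)] below by [ln_lower_bound] and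
    integrating, the mean of the distance [s] is [rho + d^2 / (3 rho)], that
    of [1 / s] is [1 / rho], and the whole is
    [ln rho + d^2 / (6 rho^2) >= 1/2 ln (rho^2 + d^2 / 3)].  Finally
    [rho^2 + d^2 / 3 = c + r^2 + w^2 - 2 d^2 / 3]. *)
Lemma log_step r w c : 1 <= c ->
  ((2^-1 * ln (c + r ^+ 2 + w ^+ 2 / 3))%:E <=
   \int[unif]_y (2^-1 * ln (c + Num.sqrt (step_sq r w y) ^+ 2))%:E)%E.
Proof.
move=> c1; have c0 : 0 < c := lt_le_trans ltr01 c1.
have r2 := sqr_ge0 r; have w2 := sqr_ge0 w.
have [/eqP|rw0] := eqVneq (r * w) 0.
  rewrite mulf_eq0 => rw0.
  have sE y : step_sq r w y = r ^+ 2 + w ^+ 2.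
    by rewrite /step_sq; case/orP: rw0 => /eqP ->; rewrite ?(mulr0, mul0r) addr0.
  under eq_integral do rewrite sE sqr_sqrtr ?addr_ge0//.
  rewrite integral_cst// [X in (_ * X)%E]probability_setT mule1 lee_fin.
  rewrite ler_wpM2l ?invr_ge0// ler_ln ?posrE; lra.
pose f y := 2^-1 * ln (c + Num.sqrt (step_sq r w y) ^+ 2).
pose X y := c + step_sq r w y.
have B0 : 2 * r * w != 0 by rewrite -mulrA mulf_neq0.
have X0 y : -1 <= y <= 1 -> 0 < X y.
  by move=> /(step_sq_ge r w) h; apply: (ltr_wpDr _ c0); apply: le_trans h; rewrite sqr_ge0.
have DX y : is_derive y 1 X (2 * r * w).
  have := is_derive_add (is_derive_cst (c : R) y 1) (is_derive_step_sq r w y).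
  by rewrite add0r.
pose a := Num.sqrt (X 1); pose b := Num.sqrt (X (-1)).
have X1E : X 1 = c + (r + w) ^+ 2 by rewrite /X /step_sq; ring.
have XN1E : X (-1) = c + (r - w) ^+ 2 by rewrite /X /step_sq; ring.
have a2 : a ^+ 2 = c + (r + w) ^+ 2.
  by rewrite sqr_sqrtr ?X1E// addr_ge0 ?sqr_ge0// ltW.
have b2 : b ^+ 2 = c + (r - w) ^+ 2.
  by rewrite sqr_sqrtr ?XN1E// addr_ge0 ?sqr_ge0// ltW.
have ra : `|r + w| <= a by rewrite -sqrtr_sqr ler_wsqrtr// X1E; lra.
have rb : `|r - w| <= b by rewrite -sqrtr_sqr ler_wsqrtr// XN1E; lra.
have a0 : 0 < a by rewrite sqrtr_gt0 X0//; lra.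
have b0 : 0 < b by rewrite sqrtr_gt0 X0//; lra.
pose rho := (a + b) / 2; pose d := (a - b) / 2.
have rho0 : 0 < rho by rewrite divr_gt0// addr_gt0.
have aE : a = rho + d by rewrite /rho /d; field.
have bE : b = rho - d by rewrite /rho /d; field.
have BE : 2 * r * w = 2 * rho * d.
  have : a ^+ 2 - b ^+ 2 = 4 * rho * d by rewrite aE bE; ring.
  by rewrite a2 b2; lra.
have AE : c + r ^+ 2 + w ^+ 2 = rho ^+ 2 + d ^+ 2.
  have : a ^+ 2 + b ^+ 2 = 2 * (rho ^+ 2 + d ^+ 2) by rewrite aE bE; ring.
  by rewrite a2 b2; lra.
(* From [rho * d = r * w] and [`|r| <= rho]. *)
have dw : d ^+ 2 <= w ^+ 2.
  have rrho : `|r| <= rho.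
    have : `|(r + w) + (r - w)| <= a + b.
      by apply: (le_trans (ler_normD _ _)); exact: lerD.
    rewrite (_ : r + w + (r - w) = 2 * r); last by ring.
    by rewrite normrM ger0_norm// /rho; lra.
  have : `|rho * d| = `|r * w| by congr `|_|; lra.
  rewrite (normrM rho) (normrM r) (gtr0_norm rho0) => E.
  rewrite -[d ^+ 2]real_normK ?num_real// -[w ^+ 2]real_normK ?num_real//.
  rewrite ler_pXn2r ?nnegrE// -(ler_pM2l rho0) E ler_wpM2r//.
have d0 : d != 0.
  by apply: contra_neq B0 => d0; rewrite BE d0 mulr0.
clearbody rho d.
pose g y := ln rho + (- ((Num.sqrt (X y) / rho) ^+ 2 / 6) + Num.sqrt (X y) / rho
  - 2^-1 - (3 * (Num.sqrt (X y) / rho))^-1).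
(* An antiderivative of [g], a polynomial in [Num.sqrt (X y)] because
   the derivative of [X] is constant. *)
pose G y := ln rho * y + (2 * r * w)^-1 * ((- (12 * rho ^+ 2)^-1) * Num.sqrt (X y) ^+ 4
  + (2 / 3 / rho) * Num.sqrt (X y) ^+ 3 - 2^-1 * Num.sqrt (X y) ^+ 2
  - (2 / 3 * rho) * Num.sqrt (X y)).
have cX : continuous (fun y => Num.sqrt (X y)).
  move=> y; apply: (@continuous_comp _ _ _ X Num.sqrt).
    exact: (is_derive_continuous (DX y)).
  exact: sqrt_continuous.
have cf : continuous f.
  move=> y; apply: (@continuous_comp _ _ _ (fun y => Num.sqrt (step_sq r w y))
    (fun u => 2^-1 * ln (c + u ^+ 2))).
    exact: continuous_sqrt_step.
  exact: cln.
have f0 y : 0 <= f y.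
  rewrite mulr_ge0 ?invr_ge0// ln_ge0// (le_trans c1)// lerDl sqr_ge0//.
apply: le_trans (@FTC_unif_ge _ f g G cf f0 _ _ _ _).
- rewrite lee_fin.
  have -> : (G 1 - G (-1)) / 2 = ln rho + d ^+ 2 / (6 * rho ^+ 2).
    rewrite /G -/a -/b aE bE BE; field; by rewrite d0 gt_eqF.
  have q0 : 0 <= d ^+ 2 / (3 * rho ^+ 2).
    apply: divr_ge0; first exact: sqr_ge0.
    by apply: mulr_ge0 => //; exact: sqr_ge0.
  have h : ln (1 + d ^+ 2 / (3 * rho ^+ 2)) <= d ^+ 2 / (3 * rho ^+ 2).
    by apply: le_ln1Dx; apply: lt_le_trans q0; lra.
  have p1 : 0 < 1 + d ^+ 2 / (3 * rho ^+ 2) by exact: ltr_wpDr.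
  have rho2 : 0 < rho ^+ 2 by rewrite exprn_gt0.
  have : ln (c + r ^+ 2 + w ^+ 2 / 3) <= ln (rho ^+ 2 * (1 + d ^+ 2 / (3 * rho ^+ 2))).
    have E : rho ^+ 2 * (1 + d ^+ 2 / (3 * rho ^+ 2)) = rho ^+ 2 + d ^+ 2 / 3.
      by field; rewrite gt_eqF.
    have d2 := sqr_ge0 d.
    by rewrite E ler_ln ?posrE; lra.
  rewrite lnM ?posrE// lnXn// => h2.
  have -> : d ^+ 2 / (6 * rho ^+ 2) = 2^-1 * (d ^+ 2 / (3 * rho ^+ 2)).
    by field; rewrite gt_eqF.
  move: h h2; rewrite mulr2n; lra.
- move=> y y1.
  have sX0 : Num.sqrt (X y) != 0 by rewrite gt_eqF// sqrtr_gt0 X0.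
  have q : {for y, continuous (fun y => Num.sqrt (X y) / rho)}.
    by apply: cvgM; [exact: cX|exact: cvg_cst].
  apply: cvgD; first exact: cvg_cst.
  apply: cvgB.
    apply: cvgB; last exact: cvg_cst.
    apply: cvgD; last exact: q.
    apply: cvgN; apply: cvgM; last exact: cvg_cst.
    apply: (@continuous_comp _ _ _ (fun y => Num.sqrt (X y) / rho) (fun u => u ^+ 2)).
      exact: q.
    exact: exprn_continuous.
  apply: cvgV; first by rewrite !mulf_neq0// invr_neq0// gt_eqF.
  by apply: cvgM; [exact: cvg_cst|exact: q].
- have cp n : continuous (fun y => Num.sqrt (X y) ^+ n).
    move=> y; apply: (@continuous_comp _ _ _ (fun y => Num.sqrt (X y)) (fun u => u ^+ n)).
      exact: cX.
    exact: exprn_continuous.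
  move=> y; apply: cvgD; first by apply: cvgM; [exact: cvg_cst|exact: cvg_id].
  apply: cvgM; first exact: cvg_cst.
  apply: cvgB; last by apply: cvgM; [exact: cvg_cst|exact: cX].
  apply: cvgB; last by apply: cvgM; [exact: cvg_cst|exact: cp].
  apply: cvgD; first by apply: cvgM; [exact: cvg_cst|exact: cp].
  by apply: cvgM; [exact: cvg_cst|exact: cp].
- move=> y y1; have Xy : 0 < X y by apply: X0; lra.
  have sX0 : Num.sqrt (X y) != 0 by rewrite gt_eqF// sqrtr_gt0.
  have Ds := is_derive_comp (DX y) (is_derive1_sqrt Xy).
  apply: (is_derive_eq (is_derive_add (is_derive_scale (ln rho) (is_derive_id y 1))
    (is_derive_scale (2 * r * w)^-1 (is_derive_sub (is_derive_sub (is_derive_add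
    (is_derive_scale (- (12 * rho ^+ 2)^-1) (is_derive_exp 3 Ds))
    (is_derive_scale (2 / 3 / rho) (is_derive_exp 2 Ds)))
    (is_derive_scale 2^-1 (is_derive_exp 1 Ds)))
    (is_derive_scale (2 / 3 * rho) Ds))))).
  rewrite /g; field.
  move: B0; rewrite !mulf_eq0 !negb_or => /andP[/andP[_ r0] w0].
  by rewrite (gt_eqF rho0) sX0 w0 r0.
- move=> y y1; have Xy := X0 y y1.
  have sX0 : 0 < Num.sqrt (X y) by rewrite sqrtr_gt0.
  have sr0 : 0 < Num.sqrt (X y) / rho by rewrite divr_gt0.
  have := ln_lower_bound sr0; rewrite ln_div ?posrE// => h.
  rewrite /f.
  have -> : c + Num.sqrt (step_sq r w y) ^+ 2 = Num.sqrt (X y) ^+ 2.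
    rewrite !sqr_sqrtr//; first exact: ltW.
    by apply: le_trans (step_sq_ge r w y1); rewrite sqr_ge0.
  rewrite lnXn// -(mulr_natl (ln _)) mulKf ?pnatr_eq0//.
  by move: h; rewrite lerBrDl.
Qed.

End LogStep.

(** * Integration against product laws *)
Section ProductLawIntegral.
Context {R : realType}.
Local Notation RR := (measurableTypeR R).
Local Open Scope ereal_scope.

Lemma ge0_integral_product_lawS n (P : 'I_n.+1 -> probability RR R)
    (F : n.+1.-tuple RR -> \bar R) :
  measurable_fun [set: n.+1.-tuple RR] F -> (forall t, 0 <= F t) ->
  \int[product_law P]_t F t =
  \int[P ord0]_a \int[product_law (fun i => P (lift ord0 i))]_t F (cons_pair (a, t)).
Proof.
move=> mF F0 /=.
rewrite ge0_integral_distribution//.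
rewrite (fubini_tonelli1 (fun p => F (cons_pair p)))//.
exact: (measurableT_comp mF (@measurable_cons_pair R n)).
Qed.

Lemma ge0_integral_product_lawS_swap n (P : 'I_n.+1 -> probability RR R)
    (F : n.+1.-tuple RR -> \bar R) :
  measurable_fun [set: n.+1.-tuple RR] F -> (forall t, 0 <= F t) ->
  \int[product_law P]_t F t =
  \int[product_law (fun i => P (lift ord0 i))]_t \int[P ord0]_a F (cons_pair (a, t)).
Proof.
move=> mF F0 /=.
rewrite ge0_integral_distribution//.
rewrite (fubini_tonelli2 (fun p => F (cons_pair p)))//.
exact: (measurableT_comp mF (@measurable_cons_pair R n)).
Qed.

Lemma integral_product_law0 (P : 'I_0 -> probability RR R) (F : 0.-tuple RR -> \bar R) :
  measurable_fun [set: 0.-tuple RR] F -> \int[product_law P]_t F t = F [tuple].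
Proof. by move=> mF /=; rewrite integral_dirac// diracT mul1e. Qed.

End ProductLawIntegral.

Section ProductLawTransfer.
Context {R : realType}.
Local Notation RR := (measurableTypeR R).
Local Open Scope ereal_scope.

Definition map_coords n (h : 'I_n -> RR -> RR) (t : n.-tuple RR) : n.-tuple RR :=
  [tuple h i (tnth t i) | i < n].

Lemma measurable_map_coords n (h : 'I_n -> RR -> RR) :
  (forall i, measurable_fun [set: RR] (h i)) ->
  measurable_fun [set: n.-tuple RR] (map_coords h).
Proof.
move=> mh; apply/measurable_fun_tnthP => i.
rewrite (_ : _ \o _ = h i \o (@tnth n RR ^~ i)).
  by apply: measurableT_comp => //; exact: measurable_tnth.
by apply/funext => t /=; rewrite tnth_mktuple.
Qed.

Lemma map_coords_cons n (h : 'I_n.+1 -> RR -> RR) a (t : n.-tuple RR) :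
  map_coords h (cons_pair (a, t)) =
  cons_pair (h ord0 a, map_coords (fun i => h (lift ord0 i)) t).
Proof.
apply: eq_from_tnth => i; rewrite tnth_mktuple /cons_pair.
by case: (unliftP ord0 i) => [k ->|->]; rewrite ?tnthS ?tnth0// tnth_mktuple.
Qed.

(** If [h i] transports [Q i] to [P i] for every [i], then acting by [h]
    coordinatewise transports one product law to the other.  Transport
    is expressed through nonnegative integrands because Tonelli's theorem then
    gives the induction on the number of coordinates. *)
Lemma ge0_integral_product_law_map n (P Q : 'I_n -> probability RR R)
    (h : 'I_n -> RR -> RR) (F : n.-tuple RR -> \bar R) :
  (forall i, measurable_fun [set: RR] (h i)) ->
  (forall i (g : RR -> \bar R), measurable_fun [set: RR] g ->
    (forall y, 0 <= g y) -> \int[P i]_y g y = \int[Q i]_y g (h i y)) ->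
  measurable_fun [set: n.-tuple RR] F -> (forall t, 0 <= F t) ->
  \int[product_law P]_t F t = \int[product_law Q]_t F (map_coords h t).
Proof.
elim: n P Q h F => [|n IH] P Q h F mh PQ mF F0.
  rewrite !integral_product_law0//; last first.
    by apply: measurableT_comp => //; exact: measurable_map_coords.
  by congr F; apply: eq_from_tnth; case.
have mFh := measurableT_comp mF (measurable_map_coords mh).
rewrite !ge0_integral_product_lawS//.
have mFc := measurableT_comp mF (@measurable_cons_pair R n).
pose P' i := P (lift ord0 i); pose Q' i := Q (lift ord0 i).
pose h' i := h (lift ord0 i).
transitivity (\int[P ord0]_a \int[product_law Q']_t
    F (cons_pair (a, map_coords h' t))).
  apply: eq_integral => a _.
  apply: (IH P' Q' h' (fun t => F (cons_pair (a, t)))).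
  - by move=> i; exact: mh.
  - by move=> i; exact: PQ.
  - by apply: (measurableT_comp mFc); exact: pair1_measurable.
  - by [].
rewrite PQ; last 2 first.
- have mG : measurable_fun [set: RR * n.-tuple RR]
      (fun p => F (cons_pair (p.1, map_coords h' p.2))).
    apply: (measurableT_comp mFc); apply/measurable_fun_pair => //=.
    apply: measurableT_comp => //; apply: measurable_map_coords => i.
    exact: mh.
  by apply: (measurable_fun_fubini_tonelli_F _ mG) => p; exact: F0.
- by move=> y; apply: integral_ge0 => t _.
apply: eq_integral => a _; apply: eq_integral => t _.
by rewrite map_coords_cons.
Qed.

Definition set_coord n (i : 'I_n) (a : RR) (t : n.-tuple RR) : n.-tuple RR :=
  [tuple if k == i then a else tnth t k | k < n].

Lemma tnth_set_coord n (i : 'I_n) a (t : n.-tuple RR) : 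
  tnth (set_coord i a t) i = a.
Proof. by rewrite tnth_mktuple eqxx. Qed.

Lemma set_coord0_cons n a b (t : n.-tuple RR) :
  set_coord ord0 a (cons_pair (b, t)) = cons_pair (a, t).
Proof.
apply: eq_from_tnth => i; rewrite tnth_mktuple /cons_pair.
by case: (unliftP ord0 i) => [k ->|->]; rewrite ?tnthS ?tnth0 ?eqxx.
Qed.

Lemma set_coordS_cons n (i : 'I_n) a b (t : n.-tuple RR) :
  set_coord (lift ord0 i) a (cons_pair (b, t)) = cons_pair (b, set_coord i a t).
Proof.
apply: eq_from_tnth => k; rewrite tnth_mktuple /cons_pair.
case: (unliftP ord0 k) => [l ->|->]; last by rewrite !tnth0 (negbTE (neq_lift _ _)).
by rewrite !tnthS tnth_mktuple (inj_eq lift_inj).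
Qed.

(** A bound on the means along one coordinate, uniform in the other
    coordinates, is a bound on the mean. *)
Lemma integral_product_law_coord_le n (P : 'I_n -> probability RR R) (i : 'I_n)
    (F : n.-tuple RR -> \bar R) (C : \bar R) :
  measurable_fun [set: n.-tuple RR] F -> (forall t, 0 <= F t) ->
  (forall t, \int[P i]_a F (set_coord i a t) <= C) ->
  \int[product_law P]_t F t <= C.
Proof.
elim: n P i F => [|n IH] P i F mF F0 FC; first by case: i {FC}.
have mFc := measurableT_comp mF (@measurable_cons_pair R n).
have avg d (T : measurableType d) (p : probability T R) (G : T -> \bar R) :
    measurable_fun [set: T] G -> (forall t, 0 <= G t) -> (forall t, G t <= C) ->
    \int[p]_t G t <= C.
  move=> mG G0 GC; apply: (@le_trans _ _ (\int[p]_t (cst C t))).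
    exact: ge0_le_integral.
  by rewrite integral_cst// [X in _ * X]probability_setT mule1.
move: FC; case: (unliftP ord0 i) => [k ->|->] FC.
  rewrite ge0_integral_product_lawS//; apply: avg.
  - by apply: (measurable_fun_fubini_tonelli_F _ mFc) => p; exact: F0.
  - by move=> a; apply: integral_ge0 => t _.
  move=> a; apply: (IH _ k) => //.
  - by apply: (measurableT_comp mFc); exact: pair1_measurable.
  - move=> t; have := FC (cons_pair (a, t)).
    by under eq_integral do rewrite set_coordS_cons.
rewrite ge0_integral_product_lawS_swap//; apply: avg.
- by apply: (measurable_fun_fubini_tonelli_G _ mFc) => p; exact: F0.
- by move=> t; apply: integral_ge0 => a _.
move=> t; have := FC (cons_pair (0%R, t)).
by under eq_integral do rewrite set_coord0_cons.
Qed.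

End ProductLawTransfer.

(** * The mean potential of a weighted sum *)
Section SmallBallLogMoment.
Context {R : realType}.
Local Notation RR := (measurableTypeR R).

Definition lin n (w : 'I_n -> R) (t : n.-tuple RR) : R :=
  \sum_(i < n) w i * tnth t i.

Definition unif_law n : probability (n.-tuple RR) R :=
  product_law (fun _ : 'I_n => unif).

Lemma measurable_lin n (w : 'I_n -> R) :
  measurable_fun [set: n.-tuple RR] (lin w).
Proof.
apply: measurable_sum => i; apply: measurable_funM => //.
exact: measurable_tnth.
Qed.

Lemma lin_cons n (w : 'I_n.+1 -> R) a (t : n.-tuple RR) :
  lin w (cons_pair (a, t)) = w ord0 * a + lin (fun i => w (lift ord0 i)) t.
Proof.
rewrite /lin big_ord_recl /cons_pair tnth0; congr (_ + _).
by apply: eq_bigr => i _; rewrite tnthS.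
Qed.

(** Joint measurability comes for free from the expression of [mean_pot] as a
    partial integral. *)
Lemma measurable_mean_pot d (T : measurableType d) (g h : T -> R) :
  measurable_fun [set: T] g -> measurable_fun [set: T] h ->
  measurable_fun [set: T] (fun t => mean_pot (g t) (h t)).
Proof.
move=> mg mh; apply/measurable_EFinP.
rewrite (_ : _ \o _ = fubini_F unif (fun p : T * RR =>
    (pot (h p.1 + g p.1 * p.2))%:E)); last first.
  by apply/funext => t /=; rewrite -mean_potE.
apply: measurable_fun_fubini_tonelli_F; last by move=> p; rewrite lee_fin pot_ge0.
apply/measurable_EFinP.
apply: (@measurableT_comp _ _ _ _ _ _ (@pot R)).
  by apply: continuous_measurable_fun; exact: continuous_pot.
apply: measurable_funD; first exact: measurableT_comp.
by apply: measurable_funM => //; exact: measurableT_comp.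
Qed.

Lemma mean_pot0 (r : R) : mean_pot r 0 = 2^-1 * ln (1 + r ^+ 2).
Proof.
rewrite /mean_pot; case: eqVneq => [->|r0].
  by rewrite /pot expr0n addr0 ln1 mul0r mulr0 addr0.
by rewrite add0r sub0r pot1N /pot1; field.
Qed.

(** Induction on the number of steps, starting at distance [r] from the
    origin: [archimedes] turns the first step into a random new distance, the
    induction hypothesis handles the remaining steps from there, and
    [log_step] averages over the new distance. *)
Lemma mean_pot_lin_ge n (w : 'I_n -> R) (r : R) :
  ((2^-1 * ln (1 + r ^+ 2 + (\sum_(i < n) w i ^+ 2) / 3))%:E <=
   \int[unif_law n]_t (mean_pot r (lin w t))%:E)%E.
Proof.
elim: n w r => [|n IH] w r.
  rewrite integral_product_law0; last first.
    by apply/measurable_EFinP; apply: measurable_mean_pot => //; exact: measurable_lin.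
  by rewrite /lin !big_ord0 mul0r addr0 mean_pot0.
have mlin := @measurable_lin n (fun i => w (lift ord0 i)).
rewrite ge0_integral_product_lawS_swap; last 2 first.
- by apply/measurable_EFinP; apply: measurable_mean_pot => //; exact: measurable_lin.
- by move=> t; rewrite lee_fin mean_pot_ge0.
set V := \sum_(i < n) w (lift ord0 i) ^+ 2.
have V0 : 0 <= V by apply: sumr_ge0 => i _; exact: sqr_ge0.
pose s (y : R) := Num.sqrt (step_sq r (w ord0) y).
have ms : measurable_fun [set: RR] s.
  by apply: continuous_measurable_fun; exact: continuous_sqrt_step.
have -> : (\int[unif_law n]_t \int[unif]_y
    (mean_pot r (lin w (cons_pair (y, t))))%:E =
  \int[unif]_y \int[unif_law n]_t (mean_pot (s y)
    (lin (fun i => w (lift ord0 i)) t))%:E)%E.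
  have m : measurable_fun [set: RR * n.-tuple RR] (fun p =>
      (mean_pot (s p.1) (lin (fun i => w (lift ord0 i)) p.2))%:E).
    apply/measurable_EFinP; apply: measurable_mean_pot.
      exact: measurableT_comp.
    exact: measurableT_comp.
  rewrite (fubini_tonelli _ m); last by move=> p; rewrite lee_fin mean_pot_ge0.
  apply: eq_integral => t _; rewrite /= /s -archimedes.
  by apply: eq_integral => y _; rewrite lin_cons addrC.
apply: le_trans (_ : _ <= \int[unif]_y
   (2^-1 * ln (1 + V / 3 + s y ^+ 2))%:E)%E _.
  rewrite big_ord_recl -/V.
  have -> : 1 + r ^+ 2 + (w ord0 ^+ 2 + V) / 3 = (1 + V / 3) + r ^+ 2 + w ord0 ^+ 2 / 3.
    by field.
  by apply: log_step; rewrite lerDl divr_ge0.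
have pos y : 1 <= 1 + V / 3 + s y ^+ 2.
  by rewrite -addrA lerDl addr_ge0 ?sqr_ge0// divr_ge0.
apply: ge0_le_integral => //.
- by move=> y _; rewrite lee_fin mulr_ge0 ?invr_ge0// ln_ge0.
- apply/measurable_EFinP; apply: measurable_funM => //.
  apply: (@measurableT_comp _ _ _ _ _ _ (@ln R)); first exact: measurable_ln.
  by apply: measurable_funD => //; exact: measurable_funX.
- have m : measurable_fun [set: RR * n.-tuple RR] (fun p =>
      (mean_pot (s p.1) (lin (fun i => w (lift ord0 i)) p.2))%:E).
    apply/measurable_EFinP; apply: measurable_mean_pot.
      exact: measurableT_comp.
    exact: measurableT_comp.
  by apply: (measurable_fun_fubini_tonelli_F _ m) => p; rewrite lee_fin mean_pot_ge0.
- by move=> y _; rewrite addrAC; exact: IH.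
Qed.

Lemma pot_lin_ge n (w : 'I_n -> R) :
  ((2^-1 * ln (1 + (\sum_(i < n) w i ^+ 2) / 3))%:E <=
   \int[unif_law n]_t (pot (lin w t))%:E)%E.
Proof.
have := mean_pot_lin_ge w 0; rewrite expr0n addr0.
by under eq_integral do rewrite /mean_pot eqxx.
Qed.

End SmallBallLogMoment.

(** * Mean inverse square roots *)
Section InverseSquareRoot.
Context {R : realType}.
Local Notation RR := (measurableTypeR R).
Implicit Types (e s u v k : R).

(** The value at [0] is the limit, so that bounds on the mean of [inv_sqrt]
    also say that [0] is taken with probability zero. *)
Definition inv_sqrt s : \bar R :=
  if s == 0 then +oo%E else ((Num.sqrt `|s|)^-1)%:E.

Lemma inv_sqrt_ge0 s : (0 <= inv_sqrt s)%E.
Proof.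
by rewrite /inv_sqrt; case: ifP => // _; rewrite lee_fin invr_ge0 sqrtr_ge0.
Qed.

(** Regularized square root of [`|s|], smooth for [e > 0]. *)
Definition fourth_root e s : R := Num.sqrt (Num.sqrt (s ^+ 2 + e ^+ 2)).

Lemma fourth_root_gt0 e s : 0 < e -> 0 < fourth_root e s.
Proof.
by move=> e0; rewrite !sqrtr_gt0 ltr_wpDl ?sqr_ge0// exprn_gt0.
Qed.

Lemma fourth_rootX e s : fourth_root e s ^+ 4 = s ^+ 2 + e ^+ 2.
Proof.
by rewrite (exprM _ 2 2) sqr_sqrtr ?sqrtr_ge0// sqr_sqrtr// addr_ge0 ?sqr_ge0.
Qed.

Lemma sqrt_norm_le_fourth_root e s : Num.sqrt `|s| <= fourth_root e s.
Proof.
by rewrite !ler_wsqrtr// -sqrtr_sqr ler_wsqrtr// lerDl sqr_ge0.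
Qed.

Lemma is_derive_fourth_root e s : 0 < e ->
  is_derive s 1 (fourth_root e) (s / (2 * fourth_root e s ^+ 3)).
Proof.
move=> e0; have q0 := fourth_root_gt0 s e0.
have p0 : 0 < s ^+ 2 + e ^+ 2 by rewrite ltr_wpDl ?sqr_ge0// exprn_gt0.
have p1 : 0 < Num.sqrt (s ^+ 2 + e ^+ 2) by rewrite sqrtr_gt0.
have D0 := is_derive_add (is_derive_exp 1 (is_derive_id s 1))
  (is_derive_cst (e ^+ 2) s 1).
apply: (is_derive_eq (is_derive_comp (is_derive_comp D0 (is_derive1_sqrt p0))
  (is_derive1_sqrt p1))).
have -> : Num.sqrt (s ^+ 2 + e ^+ 2) = fourth_root e s ^+ 2.
  by rewrite sqr_sqrtr// ltW.
rewrite sqrtr_sqr (gtr0_norm q0); field.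
by rewrite gt_eqF.
Qed.

(** The derivative of [s / fourth_root e s] is at least half of
    [(fourth_root e s)^-1], while the function itself is at most
    [Num.sqrt `|s|] for every [e]; this bounds the integral of
    [(fourth_root e s)^-1] uniformly in [e]. *)
Let Phi e s : R := s / fourth_root e s.

Let dPhi e s : R := (fourth_root e s ^+ 4 + e ^+ 2) / (2 * fourth_root e s ^+ 5).

Let is_derive_Phi e s : 0 < e -> is_derive s 1 (Phi e) (dPhi e s).
Proof.
move=> e0; have q0 : fourth_root e s != 0 by rewrite gt_eqF// fourth_root_gt0.
apply: (is_derive_eq (is_derive_mul (is_derive_id s 1)
  (is_deriveV q0 (is_derive_fourth_root s e0)))).
rewrite /GRing.scale/= /dPhi.
have -> : e ^+ 2 = fourth_root e s ^+ 4 - s ^+ 2 by rewrite fourth_rootX; ring.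
by field.
Qed.

Let Phi_le e s : 0 < e -> `|Phi e s| <= Num.sqrt `|s|.
Proof.
move=> e0; have q0 := fourth_root_gt0 s e0.
rewrite normrM normfV (gtr0_norm q0) ler_pdivrMr//.
apply: (@le_trans _ _ (Num.sqrt `|s| * Num.sqrt `|s|)).
  by rewrite -expr2 sqr_sqrtr.
by rewrite ler_wpM2l ?sqrtr_ge0// sqrt_norm_le_fourth_root.
Qed.

Lemma continuous_fourth_root e : 0 < e -> continuous (fourth_root e).
Proof. by move=> e0 s; exact: (is_derive_continuous (is_derive_fourth_root s e0)). Qed.

Lemma integral_inv_fourth_root_le e v : 0 < e -> `|v| <= 1 ->
  (\int[unif]_u ((fourth_root e (- v + u))^-1)%:E <= 3%:E)%E.
Proof.
move=> e0 v1.
have D u : is_derive u 1 (fun u : R => 2 * Phi e (- v + u)) (2 * dPhi e (- v + u)).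
  apply: (is_derive_eq (is_derive_scale 2
    (is_derive_comp (is_derive_shift (- v) u) (is_derive_Phi _ e0)))).
  by rewrite mul1r.
have cq : continuous (fun u : R => fourth_root e (- v + u)).
  move=> u; apply: (@continuous_comp _ _ _ (fun u => - v + u) (fourth_root e)).
    exact: continuous_shift.
  exact: continuous_fourth_root.
have cX n : continuous (fun u : R => fourth_root e (- v + u) ^+ n).
  move=> u; apply: (@continuous_comp _ _ _ (fun u => fourth_root e (- v + u))
    (fun u => u ^+ n)); first exact: cq.
  exact: exprn_continuous.
have cd : continuous (fun u : R => 2 * dPhi e (- v + u)).
  move=> u; apply: cvgM; first exact: cvg_cst.
  apply: cvgM.
    by apply: cvgD; [exact: cX|exact: cvg_cst].
  apply: cvgV.
    by rewrite mulf_neq0// expf_neq0// gt_eqF// fourth_root_gt0.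
  by apply: cvgM; [exact: cvg_cst|exact: cX].
have d0 u : 0 <= 2 * dPhi e (- v + u).
  have q0 := ltW (fourth_root_gt0 (- v + u) e0).
  apply: mulr_ge0 => //; apply: divr_ge0.
    by apply: addr_ge0; [exact: exprn_ge0|exact: sqr_ge0].
  by apply: mulr_ge0 => //; exact: exprn_ge0.
apply: (@le_trans _ _ (\int[unif]_u (2 * dPhi e (- v + u))%:E)%E).
  apply: ge0_le_integral => //.
  - by move=> u _; rewrite lee_fin invr_ge0 ltW// fourth_root_gt0.
  - apply/measurable_EFinP; apply: continuous_measurable_fun => u.
    by apply: cvgV; [rewrite gt_eqF// fourth_root_gt0|exact: cq].
  - by apply/measurable_EFinP; exact: continuous_measurable_fun.
  - move=> u _; rewrite lee_fin /dPhi.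
    have q0 := fourth_root_gt0 (- v + u) e0.
    set q := fourth_root _ _ in q0 *.
    have -> : 2 * ((q ^+ 4 + e ^+ 2) / (2 * q ^+ 5)) = q^-1 + e ^+ 2 / q ^+ 5.
      by field; rewrite gt_eqF.
    by rewrite lerDl divr_ge0 ?sqr_ge0// exprn_ge0// ltW.
rewrite (@FTC_unif _ _ (fun u => 2 * Phi e (- v + u)))//; last first.
  by move=> u; exact: (is_derive_continuous (D u)).
rewrite lee_fin.
have s2 : Num.sqrt (2 : R) <= 3 / 2.
  by rewrite -[3 / 2]ger0_norm// -sqrtr_sqr ler_wsqrtr//; lra.
have h1 : `|Phi e (- v + 1)| <= 3 / 2.
  apply: le_trans (Phi_le _ e0) (le_trans _ s2); rewrite ler_wsqrtr//.
  move: v1; rewrite !ler_norml; lra.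
have h2 : `|Phi e (- v + -1)| <= 3 / 2.
  apply: le_trans (Phi_le _ e0) (le_trans _ s2); rewrite ler_wsqrtr//.
  move: v1; rewrite !ler_norml; lra.
move: h1 h2; rewrite !ler_norml; lra.
Qed.

Lemma cvg_inv_fourth_root s :
  ((fourth_root (n.+1%:R^-1) s)^-1)%:E @[n --> \oo] --> inv_sqrt s.
Proof.
rewrite /inv_sqrt; case: eqVneq => [->|s0].
  apply/cvgeryP; apply/cvgryPge => A; near=> n.
  rewrite /fourth_root expr0n add0r sqrtr_sqr ger0_norm ?invr_ge0//.
  rewrite sqrtrV// invrK.
  apply: (le_trans (ler_norm A)).
  rewrite -[`|A|]ger0_norm// -sqrtr_sqr ler_wsqrtr//.
  apply: (@le_trans _ _ n%:R); last by rewrite ler_nat.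
  near: n; exact: nbhs_infty_ger.
apply: cvg_EFin; first by near=> n.
apply: cvgV; first by rewrite gt_eqF// sqrtr_gt0 normr_gt0.
rewrite -sqrtr_sqr.
have cs := @sqrt_continuous R.
apply: continuous_cvg; first exact: cs.
apply: continuous_cvg; first exact: cs.
rewrite -[X in _ --> X]addr0.
apply: cvgD; first exact: cvg_cst.
rewrite [X in _ --> X](_ : 0 = 0 * 0); last by rewrite mulr0.
have ch := @cvg_harmonic R.
exact: (cvgM ch ch).
Unshelve. all: by end_near. Qed.

Lemma measurable_inv_sqrt : measurable_fun [set: RR] inv_sqrt.
Proof.
apply: (emeasurable_fun_cvg (fun n (s : RR) => ((fourth_root (n.+1%:R^-1) s)^-1)%:E)).
- move=> n; apply/measurable_EFinP; apply: continuous_measurable_fun => s.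
  apply: cvgV; first by rewrite gt_eqF// fourth_root_gt0.
  exact: continuous_fourth_root.
- by move=> s _; exact: cvg_inv_fourth_root.
Qed.

Lemma integral_inv_sqrt_le v : `|v| <= 1 ->
  (\int[unif]_u inv_sqrt (- v + u) <= 3%:E)%E.
Proof.
move=> v1.
pose g n (u : RR) : \bar R := ((fourth_root (n.+1%:R^-1) (- v + u))^-1)%:E.
have -> : (\int[unif]_u inv_sqrt (- v + u) = \int[unif]_u limn (g ^~ u))%E.
  by apply: eq_integral => u _; apply/esym/cvg_lim => //; exact: cvg_inv_fourth_root.
have mg n : measurable_fun [set: RR] (g n).
  apply/measurable_EFinP; apply: continuous_measurable_fun => u.
  apply: cvgV; first by rewrite gt_eqF// fourth_root_gt0.
  apply: (@continuous_comp _ _ _ (fun u => - v + u) (fourth_root _)).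
    exact: continuous_shift.
  exact: continuous_fourth_root.
have g0 n u : [set: RR] u -> (0 <= g n u)%E.
  by move=> _; rewrite lee_fin invr_ge0 ltW// fourth_root_gt0.
have ndg u : [set: RR] u -> nondecreasing_seq (g ^~ u).
  move=> _ p q pq; rewrite lee_fin lef_pV2 ?posrE ?fourth_root_gt0//.
  do 2 apply: ler_wsqrtr; rewrite lerD2l.
  apply: lerXn2r; rewrite ?nnegrE ?invr_ge0//.
  by rewrite lef_pV2 ?posrE// ler_nat.
rewrite monotone_convergence//.
apply: lime_le.
  apply: ereal_nondecreasing_is_cvgn => p q pq; apply: ge0_le_integral => //.
  - by move=> u _; exact: g0.
  - by move=> u _; exact: ndg.
by near=> n; apply: integral_inv_fourth_root_le.
Unshelve. all: by end_near. Qed.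

Lemma inv_sqrt_le k s v : 0 < k -> k * `|v| <= `|s| ->
  (inv_sqrt s <= ((Num.sqrt k)^-1)%:E * inv_sqrt v)%E.
Proof.
move=> k0; rewrite /inv_sqrt.
case: (eqVneq v 0) => [_ _|v0 kvs].
  by rewrite gt0_muley ?leey// lte_fin invr_gt0 sqrtr_gt0.
have s0 : 0 < `|s| by apply: lt_le_trans kvs; rewrite mulr_gt0 ?normr_gt0.
rewrite -normr_gt0 in v0.
rewrite -normr_eq0 gt_eqF// -EFinM lee_fin -invfM -sqrtrM ?(ltW k0)//.
by rewrite lef_pV2 ?posrE ?sqrtr_gt0 ?mulr_gt0// ler_wsqrtr.
Qed.

End InverseSquareRoot.

(** * The cube as parameter space of the perturbations *)
Section AffineChangeOfVariables.
Context {R : realType}.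
Local Notation RR := (measurableTypeR R).
Local Notation mu := (@lebesgue_measure R).

Definition affine_map (x r : R) (y : RR) : RR := x + r * y.

Lemma measurable_affine_map (x r : R) : measurable_fun [set: RR] (affine_map x r).
Proof. by apply: continuous_measurable_fun; exact: continuous_affine. Qed.

Lemma lebesgue_measure_affine (x : R) (r : {posnum R}) :
  exists2 nu : {measure set RR -> \bar R},
    forall A, nu A = pushforward mu (affine_map x r%:num) A &
    forall A, measurable A -> mu A = mscale r%:num%:nng nu A.
Proof.
unshelve refine (ex_intro2 _ _
  (pushforward mu (affine_map x r%:num) : {measure set RR -> \bar R}) _ _).
- exact: measurable_affine_map.
- by [].
move=> A mA; apply: lebesgue_measure_unique => //= _ [[a b]] _ <-.
rewrite /mscale/= /pushforward.
have r0 : 0 < r%:num by [].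
rewrite (_ : _ @^-1` _ = `](a - x) / r%:num, (b - x) / r%:num]%classic); last first.
  apply/seteqP; split => y /=; rewrite /affine_map !in_itv/=;
    by rewrite ltr_pdivrMr// ler_pdivlMr// ltrBlDl lerBrDl (mulrC y).
rewrite !lebesgue_measure_itv/= !lte_fin ltr_pM2r ?invr_gt0// ltrD2r.
case: ifP => _; last by rewrite mule0.
by rewrite -!EFinD -EFinM; congr EFin; field.
Qed.

Lemma ge0_integral_affine (x : R) (r : {posnum R}) (g : RR -> \bar R) :
  measurable_fun [set: RR] g -> (forall y, 0 <= g y)%E ->
  (\int[mu]_(y in `[(x - r%:num)%R, (x + r%:num)%R]) g y =
   r%:num%:E * \int[mu]_(y in `[(-1)%R, 1%R]) g (x + r%:num * y)%R)%E.
Proof.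
move=> mg g0.
have mI : measurable (`[x - r%:num, x + r%:num]%classic : set RR) by [].
have [nu nuE muE] := lebesgue_measure_affine x r.
rewrite (@eq_measure_integral _ _ _ _ (mscale r%:num%:nng nu)); last first.
  by move=> A mA _; exact: muE.
rewrite ge0_integral_mscale//; last exact: measurable_funTS.
congr (_ * _)%E.
rewrite (_ : nu = pushforward mu (affine_map x r%:num) :> (set RR -> \bar R)); last exact/funext.
rewrite ge0_integral_pushforward//; last 2 first.
  exact: measurable_affine_map.
  exact: measurable_funTS.
rewrite (_ : _ @^-1` _ = `[-1, 1]%classic)//.
have r0 : 0 < r%:num by [].
rewrite predeqE => y; rewrite /= /affine_map !in_itv/= !lerD2l.
rewrite -[in X in X && _](mulrN1 r%:num) ler_pM2l//.
by rewrite -[X in _ * _ <= X]mulr1 ler_pM2l.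
Qed.

End AffineChangeOfVariables.

Section Clamp.
Context {R : realType}.
Local Notation RR := (measurableTypeR R).

(** Projection on [-1, 1].  Composing with it makes the parametrization of
    the perturbations stay in the box for every tuple, not only almost surely. *)
Definition clamp (a : R) : R := Num.max (-1) (Num.min a 1).

Lemma clamp_itv a : -1 <= clamp a <= 1.
Proof.
rewrite /clamp le_max lexx/= ge_max ge_min lexx orbT andbT; lra.
Qed.

Lemma norm_clamp_le1 a : `|clamp a| <= 1.
Proof. by rewrite ler_norml clamp_itv. Qed.

Lemma clampK a : -1 <= a <= 1 -> clamp a = a.
Proof.
by move=> /andP[a1 a2]; rewrite /clamp (min_idPl a2) (max_idPr a1).
Qed.

Lemma measurable_clamp : measurable_fun [set: RR] clamp.
Proof.
apply: measurable_maxr => //; exact: measurable_minr.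
Qed.

Lemma ge0_integral_unif_clamp (g : RR -> \bar R) :
  measurable_fun [set: RR] g -> (forall y, 0 <= g y)%E ->
  (\int[unif]_y g (clamp y) = \int[unif]_y g y)%E.
Proof.
move=> mg g0; rewrite !ge0_integral_unif//; last first.
  by apply: measurableT_comp => //; exact: measurable_clamp.
by congr (_ * _)%E; apply: eq_integral => y; rewrite inE/= in_itv/= => /clampK ->.
Qed.

(** For [r = 0] the law on the left is a point mass and the map on the right
    is constant. *)
Lemma ge0_integral_uniform_law_clamp (x r : R) (g : RR -> \bar R) : 0 <= r ->
  measurable_fun [set: RR] g -> (forall y, 0 <= g y)%E ->
  (\int[uniform_law (x - r) (x + r)]_y g y =
   \int[unif]_y g (x + r * clamp y)%R)%E.
Proof.
move=> r0 mg g0.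
have mga : measurable_fun [set: RR] (fun y => g (x + r * y)%R).
  by apply: measurableT_comp => //; exact: measurable_affine_map.
rewrite (@ge0_integral_unif_clamp (fun y => g (x + r * y)%R))//.
move: r0; rewrite le_eqVlt => /predU1P[r0|r0].
  rewrite -r0 subr0 addr0 /uniform_law.
  case: {-}_ / idP => [xx|_]; first by have := xx; rewrite ltxx.
  rewrite integral_dirac// diracT mul1e.
  under eq_integral do rewrite mul0r addr0.
  by rewrite integral_cst// [X in (_ * X)%E]probability_setT mule1.
have rr : x - r < x + r by lra.
rewrite (ge0_integral_uniform_law rr)// (ge0_integral_affine x (PosNum r0))//=.
rewrite muleA -EFinM ge0_integral_unif//; congr (_ * _)%E.
by congr EFin; field; lra.
Qed.

End Clamp.

Section ContinuousOnRows.
Context {R : realType} {m : nat}.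
Local Notation RR := (measurableTypeR R).

Definition row_of (t : m.-tuple RR) : 'rV[R]_m := \row_i tnth t i.

(** An open set of rows is a countable union of boxes with rational centers
    and radii [1 / k], and boxes are measurable for the product sigma-algebra. *)
Lemma measurable_continuous_row (F : 'rV[R]_m -> R) : continuous F ->
  measurable_fun [set: m.-tuple RR] (F \o row_of).
Proof.
move=> cF; apply: (measurability _ (RGenOpens.measurableE R)).
move=> _ [_ [a [b ->] <-]]; rewrite setTI.
set O := F @^-1` `]a, b[.
have oO : open O.
  by move/continuousP: cF; apply; exact: interval_open.
rewrite comp_preimage -/O.
pose ok (p : nat * {ffun 'I_m -> rat}) :=
  `[< forall y : 'rV[R]_m, (forall i, `|y 0 i - ratr (p.2 i)| < p.1.+1%:R^-1) -> O y >].
pose box (p : nat * {ffun 'I_m -> rat}) : set (m.-tuple RR) :=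
  \bigcap_(i in [set: 'I_m]) [set t | `|tnth t i - ratr (p.2 i)| < p.1.+1%:R^-1].
rewrite (_ : _ @^-1` _ = \bigcup_p if ok p then box p else set0).
  apply: countable_bigcupT_measurable; first exact: countableP.
  move=> p; case: ifP => // _.
  apply: fin_bigcap_measurable; first exact: finite_finset.
  move=> i _; rewrite -[X in measurable X]setTI.
  have mn : measurable_fun [set: m.-tuple RR]
      (fun t => `|tnth t i - ratr (p.2 i)| < p.1.+1%:R^-1).
    apply: measurable_fun_ltr => //; apply: measurableT_comp => //.
    by apply: measurable_funB => //; exact: measurable_tnth.
  exact: (mn measurableT [set true]).
apply/seteqP; split => [t Ot|t [p _]]; last first.
  case: ifP => // /asboolP okp bt; apply: okp => i; rewrite mxE.
  exact: bt.
have /nbhs_ballP[e /= e0 eO] : nbhs (row_of t) O by exact: open_nbhs_nbhs.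
have [k ke] : exists k : nat, k.+1%:R^-1 < e / 2.
  have e20 : 0 < e / 2 by rewrite divr_gt0.
  have [k _ /(_ k (leqnn k))] := near_infty_natSinv_lt (PosNum e20).
  by exists k.
have k0 : 0 < k.+1%:R^-1 :> R by rewrite invr_gt0.
have /choice[q qP] : forall i : 'I_m, exists q : rat,
    `|tnth t i - ratr q| < k.+1%:R^-1.
  move: k0; set d := k.+1%:R^-1 => k0 i.
  have td : tnth t i - d < tnth t i + d by rewrite ltrD2l; lra.
  have [q] := rat_in_itvoo td.
  rewrite in_itv/= => /andP[q1 q2]; exists q.
  by rewrite ltr_norml; lra.
exists (k, [ffun i => q i]) => //.
have -> : ok (k, [ffun i => q i]).
  apply/asboolP => y yq; apply: eO; split => // i j; rewrite (ord1 i) mxE.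
  move: ke (yq j) (qP j); rewrite /ball/= ffunE.
  set d := k.+1%:R^-1; rewrite !ltr_norml; lra.
by move=> i _ /=; rewrite ffunE.
Qed.

End ContinuousOnRows.

Section PerturbationLaw.
Context {R : realType} {m : nat}.
Local Notation RR := (measurableTypeR R).
Variables (x : 'rV[R]_m) (delta : R).

Definition perturb (t : m.-tuple RR) : 'rV[R]_m :=
  \row_i (x 0 i + delta * `|x 0 i| * clamp (tnth t i)).

Let h (i : 'I_m) (y : RR) : RR := x 0 i + delta * `|x 0 i| * clamp y.

Let mh i : measurable_fun [set: RR] (h i).
Proof.
apply: (@measurableT_comp _ _ _ _ _ _ (affine_map (x 0 i) (delta * `|x 0 i|))).
  exact: measurable_affine_map.
exact: measurable_clamp.
Qed.

Let row_of_map t : row_of (map_coords h t) = perturb t.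
Proof. by apply/rowP => i; rewrite !mxE tnth_mktuple. Qed.

Lemma measurable_perturb d (T : measurableType d) (g : 'rV[R]_m -> T) :
  measurable_fun [set: m.-tuple RR] (g \o row_of) ->
  measurable_fun [set: m.-tuple RR] (g \o perturb).
Proof.
move=> mg; rewrite (_ : g \o perturb = (g \o row_of) \o map_coords h).
  by apply: measurableT_comp => //; exact: measurable_map_coords.
by apply/funext => t /=; rewrite row_of_map.
Qed.

Lemma CP_expectationE (g : 'rV[R]_m -> \bar R) : 0 <= delta ->
  measurable_fun [set: m.-tuple RR] (g \o row_of) ->
  (CP_expectation x delta g = \int[unif_law m]_t g (perturb t))%E.
Proof.
move=> delta0 mg.
have key (F : m.-tuple RR -> \bar R) : measurable_fun [set: m.-tuple RR] F ->
    (forall t, 0 <= F t)%E ->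
    (\int[CP_law x delta]_t F t = \int[unif_law m]_t F (map_coords h t))%E.
  move=> mF F0; apply: ge0_integral_product_law_map => // i f mf f0.
  by rewrite ge0_integral_uniform_law_clamp// mulr_ge0.
rewrite /CP_expectation integralE [RHS]integralE.
rewrite (key _ (measurable_funepos mg))//.
rewrite (key _ (measurable_funeneg mg))//.
by congr (_ - _)%E; apply: eq_integral => t _;
  rewrite ?funeposE ?funenegE /= row_of_map.
Qed.

Lemma perturb_CP t : 0 <= delta -> CP x delta (perturb t).
Proof.
move=> delta0 i /=; rewrite mxE addrAC subrr add0r normrM.
rewrite ger0_norm ?mulr_ge0// ler_piMr ?mulr_ge0//.
exact: norm_clamp_le1.
Qed.

Lemma CP_perturb x' : 0 < delta -> CP x delta x' ->
  exists t, x' = perturb t.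
Proof.
move=> delta0 xx'.
(* If [x 0 i = 0] the quotient is [0], by the convention on inverses. *)
exists [tuple (x' 0 i - x 0 i) / (delta * `|x 0 i|) | i < m].
apply/rowP => i; rewrite mxE tnth_mktuple.
have := xx' i; have [x0|x0] := eqVneq (x 0 i) 0.
  by rewrite x0 normr0 mulr0 subr0 normr_le0 => /eqP ->; rewrite mul0r addr0.
have d0 : 0 < delta * `|x 0 i| by rewrite mulr_gt0 ?normr_gt0.
move=> h1; rewrite clampK.
  by rewrite mulrC divfK ?gt_eqF// addrC subrK.
by rewrite -ler_norml normrM normfV (gtr0_norm d0) ler_pdivrMr// mul1r.
Qed.

End PerturbationLaw.

(** * Linearization of the error *)
Lemma cvg_EFin_squeeze (R : realType) (T : Type) (F : set_system T)
    {FF : Filter F} (u : T -> \bar R) (l : R) :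
  (forall e : R, 0 < e -> \forall t \near F, ((l - e)%:E <= u t <= (l + e)%:E)%E) ->
  u @ F --> l%:E.
Proof.
move=> H; apply: cvg_EFin.
  apply: filterS (H 1 ltr01) => t /andP[h1 h2].
  rewrite fin_numE; apply/andP; split.
    by apply: contraTneq h1 => ->; rewrite leeNy_eq.
  by apply: contraTneq h2 => ->; rewrite leye_eq.
apply/cvgrPdist_le => e e0; apply: filterS (H _ e0) => t /=.
case: (u t) => [r| |] //=.
- by rewrite !lee_fin ler_distl => /andP[h1 h2]; apply/andP; split; lra.
- by rewrite leye_eq andbF.
Qed.

Lemma mx_norm_le (R : realType) k (v : 'rV[R]_k) (c : R) : 0 <= c -> (forall i, `|v 0 i| <= c) ->
  `|v| <= c.
Proof.
move=> c0 vc; rewrite [leLHS]/Num.Def.normr/= mx_normrE.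
by apply: bigmax_le => // -[i l] _ /=; rewrite (ord1 i).
Qed.

Lemma le_mx_norm (R : realType) k (v : 'rV[R]_k) i : `|v 0 i| <= `|v|.
Proof.
rewrite [leRHS]/Num.Def.normr/= mx_normrE.
exact: (le_bigmax _ (fun p : 'I_1 * 'I_k => `|v p.1 p.2|) (0, i)).
Qed.

Section Linearization.
Context {R : realType} {m n : nat}.
Local Notation RR := (measurableTypeR R).
Variables (f : 'rV[R]_m -> 'rV[R]_n) (j : 'I_n) (x : 'rV[R]_m).
Hypothesis hf : forall y : 'rV[R]_m, differentiable f y.
Hypothesis fx0 : f x 0 j != 0.

(** The [i]-th weight is the signed component-wise condition number of
    the [i]-th input. *)
Definition weight (i : 'I_m) : R := 'J f x i j * `|x 0 i| / `|f x 0 j|.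

Definition linear_error (t : m.-tuple RR) : R :=
  \sum_(i < m) weight i * clamp (tnth t i).

Definition ratio (delta : R) (t : m.-tuple RR) : R :=
  error_ratio f j x delta (perturb x delta t).

Lemma ratio_ge0 delta t : 0 <= delta -> 0 <= ratio delta t.
Proof. by move=> d0; apply: divr_ge0 => //; exact: mulr_ge0. Qed.

Lemma continuous_error_ratio delta : continuous (error_ratio f j x delta).
Proof.
move=> y; apply: (@continuous_comp _ _ _ (fun z => f z 0 j)
  (fun u : R => `|u - f x 0 j| / (delta * `|f x 0 j|))).
  apply: (@continuous_comp _ _ _ f (fun z : 'rV[R]_n => z 0 j)).
    exact/differentiable_continuous.
  exact: coord_continuous.
apply: cvgM; last exact: cvg_cst.
by apply: cvg_norm; apply: cvgB; [exact: cvg_id|exact: cvg_cst].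
Qed.

Lemma measurable_error_ratio delta :
  measurable_fun [set: m.-tuple RR] (error_ratio f j x delta \o @row_of R m).
Proof. by apply: measurable_continuous_row; exact: continuous_error_ratio. Qed.

Lemma measurable_ratio delta : measurable_fun [set: m.-tuple RR] (ratio delta).
Proof. exact: (measurable_perturb _ _ (measurable_error_ratio delta)). Qed.

Lemma measurable_linear_error : measurable_fun [set: m.-tuple RR] linear_error.
Proof.
apply: measurable_sum => i; apply: measurable_funM => //.
apply: measurableT_comp; first exact: measurable_clamp.
exact: measurable_tnth.
Qed.

Lemma differential_approx (eps : R) : 0 < eps -> exists2 d : R, 0 < d &
  forall h : 'rV[R]_m, `|h| < d ->
    `|f (x + h) 0 j - f x 0 j - \sum_(i < m) h 0 i * 'J f x i j| <= eps * `|h|.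
Proof.
move=> eps0.
have /diff_locallyP[_ /eqaddoP/(_ _ eps0)] := hf x.
move=> /nbhs_normP[d /= d0 H]; exists d => // h hd.
have := H h; rewrite /= sub0r normrN => /(_ hd).
apply: le_trans.
have -> : \sum_(i < m) h 0 i * 'J f x i j = ('d f x h) 0 j.
  by rewrite -deriveE// deriveEjacobian// mxE.
rewrite (addrC x h).
have -> : f (h + x) 0 j - f x 0 j - ('d f x h) 0 j =
  ((f \o shift x - (cst (f x) + 'd f x)) h) 0 j.
  by rewrite !fctE !mxE opprD addrA.
exact: le_mx_norm.
Qed.

(** The remainder of the differential is [eps * `|h|], the increment [h] is
    at most [delta * `|x|], and dividing by [delta] leaves a quantity small
    uniformly over the box. *)
Lemma ratio_approx (eta : R) : 0 < eta ->
  \forall delta \near 0^'+, forall t, `|ratio delta t - `|linear_error t| | <= eta.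
Proof.
move=> eta0.
have g0 : 0 < `|f x 0 j| by rewrite normr_gt0.
pose eps := eta * `|f x 0 j| / (`|x| + 1).
have x10 : 0 < `|x| + 1 by rewrite ltr_wpDl.
have eps0 : 0 < eps by rewrite divr_gt0// mulr_gt0.
have [d d0 H] := differential_approx eps0.
near=> delta => t.
have delta0 : 0 < delta by near: delta; exact: nbhs_right_gt.
have delta1 : delta * (`|x| + 1) < d.
  rewrite -ltr_pdivlMr//; near: delta; apply: nbhs_right_lt.
  by rewrite divr_gt0.
pose h := perturb x delta t - x.
have hE i : h 0 i = delta * `|x 0 i| * clamp (tnth t i).
  by rewrite !mxE addrAC subrr add0r.
have hle : `|h| <= delta * `|x|.
  apply: mx_norm_le => [|i]; first by rewrite mulr_ge0// ltW.
  rewrite hE normrM ger0_norm ?mulr_ge0 ?(ltW delta0)//.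
  apply: (@le_trans _ _ (delta * `|x 0 i|)).
    by rewrite ler_piMr ?norm_clamp_le1// mulr_ge0// ltW.
  by rewrite ler_wpM2l ?(ltW delta0)// le_mx_norm.
have hd : `|h| < d.
  apply: le_lt_trans delta1; apply: (le_trans hle).
  by rewrite ler_wpM2l ?(ltW delta0)// lerDl.
have dg0 : 0 < delta * `|f x 0 j| by rewrite mulr_gt0.
have -> : ratio delta t = `|(f (x + h) 0 j - f x 0 j) / (delta * `|f x 0 j|)|.
  by rewrite normrM normfV (gtr0_norm dg0) /h subrKC.
have LE : linear_error t = (\sum_(i < m) h 0 i * 'J f x i j) / (delta * `|f x 0 j|).
  rewrite mulr_suml; apply: eq_bigr => i _; rewrite hE /weight.
  by field; rewrite !gt_eqF.
apply: (le_trans (ler_dist_dist _ _)).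
rewrite LE -mulrBl normrM normfV (gtr0_norm dg0) ler_pdivrMr//.
apply: (le_trans (H _ hd)); apply: (@le_trans _ _ (eps * (delta * (`|x| + 1)))).
  rewrite ler_wpM2l ?(ltW eps0)//; apply: (le_trans hle).
  by rewrite ler_wpM2l ?(ltW delta0)// lerDl.
rewrite /eps [leLHS](_ : _ = eta * (delta * `|f x 0 j|))//.
by field; rewrite gt_eqF.
Unshelve. all: by end_near. Qed.


End Linearization.

(** * Worst case and mean of the error *)
Section IntegralComparison.
Context d (T : measurableType d) {R : realType} (P : probability T R).
Local Open Scope ereal_scope.

(** Monotonicity without integrability: the integral is the difference of
    the integrals of the positive and negative parts, and these are
    monotone separately, even when infinite. *)
Lemma integral_mono (F G : T -> \bar R) :
  measurable_fun [set: T] F -> measurable_fun [set: T] G ->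
  (forall t, F t <= G t) -> \int[P]_t F t <= \int[P]_t G t.
Proof.
move=> mF mG FG; rewrite integralE [leRHS]integralE leeB//.
- apply: ge0_le_integral => //.
  + exact: measurable_funepos.
  + exact: measurable_funepos.
  + by move=> t _; rewrite !funeposE; exact: le_max2.
- apply: ge0_le_integral => //.
  + exact: measurable_funeneg.
  + exact: measurable_funeneg.
  + by move=> t _; rewrite !funenegE; apply: le_max2 => //; rewrite leeN2.
Qed.

Lemma integral_le_shift (g h : T -> R) (e : R) : (0 <= e)%R ->
  measurable_fun [set: T] g -> measurable_fun [set: T] h ->
  (forall t, 0 <= g t)%R -> (forall t, 0 <= h t)%R -> (forall t, g t <= h t + e)%R ->
  (\int[P]_t (g t)%:E <= \int[P]_t (h t)%:E + e%:E).
Proof.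
move=> e0 mg mh g0 h0 gh.
have -> : (\int[P]_t (h t)%:E + e%:E = \int[P]_t ((h t)%:E + e%:E)).
  rewrite ge0_integralD//; last 2 first.
  - by move=> t _; rewrite lee_fin.
  - exact/measurable_EFinP.
  by rewrite integral_cst//= probability_setT mule1.
apply: ge0_le_integral => //.
- by move=> t _; rewrite lee_fin.
- exact/measurable_EFinP.
- by apply: emeasurable_funD => //; exact/measurable_EFinP.
- by move=> t _; rewrite -EFinD lee_fin.
Qed.

End IntegralComparison.

Lemma measurable_lne {R : realType} : measurable_fun [set: R] (fun s : R => lne s%:E).
Proof.
rewrite (_ : (fun s => _) = fun s : R => if s <= 0 then -oo%E else (ln s)%:E).
  apply: measurable_fun_ifT => //.
    exact: measurable_fun_ler.
  by apply/measurable_EFinP; exact: measurable_ln.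
apply/funext => s; case: leP => s0; first by rewrite le0_lneNy.
by rewrite lne_EFin.
Qed.

Section MeanModulus.
Context {R : realType}.
Local Notation RR := (measurableTypeR R).

Lemma integral_unif_norm : (\int[unif]_y `|y|%:E = (2^-1 : R)%:E)%E.
Proof.
pose F (y : R) := 2^-1 * (y * Num.sqrt (y ^+ 2)).
have DF (y : R) : is_derive y 1 F `|y|.
  have [->|y0] := eqVneq y 0.
    rewrite normr0; apply/is_derive1_caratheodory.
    exists (fun z => 2^-1 * `|z|); split => [z||].
    - by rewrite /F mul0r mulr0 !subr0 sqrtr_sqr; ring.
    - by apply: cvgM; [exact: cvg_cst|exact: norm_continuous].
    - by rewrite normr0 mulr0.
  have y2 : 0 < y ^+ 2 by rewrite exprn_even_gt0.
  apply: (is_derive_eq (is_derive_scale 2^-1 (is_derive_mul (is_derive_id y 1)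
    (is_derive_comp (is_derive_exp 1 (is_derive_id y 1)) (is_derive1_sqrt y2))))).
  rewrite sqrtr_sqr expr1.
  have n0 : `|y| != 0 by rewrite normr_eq0.
  have E : y * y = `|y| * `|y| by rewrite -!expr2 real_normK ?num_real.
  rewrite mulr1 [2 * y * _](_ : _ = y / `|y|); last by field.
  by rewrite mulrA E mulfK//; field.
rewrite (@FTC_unif _ (fun y => `|y|) F).
- by rewrite /F !sqrtr_sqr normrN normr1; congr EFin; field.
- by move=> y; exact: norm_continuous.
- by move=> y; exact: normr_ge0.
- by move=> y; exact: (is_derive_continuous (DF y)).
Qed.

End MeanModulus.

Section WorstCaseAndMean.
Context {R : realType} {m n : nat}.
Local Notation RR := (measurableTypeR R).
Variables (f : 'rV[R]_m -> 'rV[R]_n) (j : 'I_n) (x : 'rV[R]_m).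
Hypothesis hf : forall y : 'rV[R]_m, differentiable f y.
Hypothesis fx0 : f x 0 j != 0.

Let w := weight f j x.
Let S := linear_error f j x.

Definition total_weight : R := \sum_(i < m) `|w i|.

Lemma total_weight_ge0 : 0 <= total_weight.
Proof. exact: sumr_ge0. Qed.

Lemma linear_error_le t : `|S t| <= total_weight.
Proof.
apply: (le_trans (ler_norm_sum _ _ _)); apply: ler_sum => i _.
by rewrite normrM ler_piMr// norm_clamp_le1.
Qed.

(** The maximum is reached at the vertex given by the signs of the weights. *)
Lemma linear_error_max : exists t, `|S t| = total_weight.
Proof.
exists [tuple Num.sg (w i) | i < m].
rewrite -[RHS]ger0_norm ?total_weight_ge0//; congr `|_|.
apply: eq_bigr => i _; rewrite tnth_mktuple -/w clampK; last first.
  by case: sgrP => _; lra.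
by rewrite mulrC -normrEsg.
Qed.

Lemma cvg_WCC_at : WCC_at f j x delta @[delta --> 0^'+] --> total_weight%:E.
Proof.
apply: cvg_EFin_squeeze => e e0; near=> delta.
have delta0 : 0 < delta by near: delta; exact: nbhs_right_gt.
have H : forall t, `|ratio f j x delta t - (`|S t|)| <= e.
  by near: delta; exact: ratio_approx.
apply/andP; split.
  have [t St] := linear_error_max.
  apply: (@le_trans _ _ (ratio f j x delta t)%:E).
    rewrite lee_fin -St; move: (H t); rewrite ler_norml; lra.
  apply: ereal_sup_ubound; exists (perturb x delta t) => //.
  by apply: perturb_CP; exact: ltW.
apply: ge_ereal_sup => _ [x' xx' <-].
have [t ->] := CP_perturb delta0 xx'.
rewrite lee_fin; move: (H t) (linear_error_le t); rewrite /ratio ler_norml; lra.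
Unshelve. all: by end_near. Qed.

Lemma WCC_E : WCC f j x = total_weight%:E.
Proof. exact/cvg_lim/cvg_WCC_at. Qed.

Definition mean_linear_error : \bar R := \int[unif_law m]_t `|S t|%:E.

Lemma measurable_norm_linear_error :
  measurable_fun [set: m.-tuple RR] (fun t => `|S t|).
Proof. by apply: measurableT_comp => //; exact: measurable_linear_error. Qed.

Lemma mean_linear_error_le : (mean_linear_error <= (total_weight / 2)%:E)%E.
Proof.
pose g (i : 'I_m) (t : m.-tuple RR) : \bar R := (`|w i| * `|clamp (tnth t i)|)%:E.
have mc i : measurable_fun [set: m.-tuple RR] (fun t => (`|clamp (tnth t i)|)%:E).
  apply/measurable_EFinP; apply: measurableT_comp => //.
  apply: measurableT_comp; first exact: measurable_clamp.
  exact: measurable_tnth.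
have mg i : measurable_fun [set: m.-tuple RR] (g i).
  exact: (measurable_funeM (`|w i|%:E) (mc i)).
apply: (@le_trans _ _ (\int[unif_law m]_t \sum_(i < m) g i t)%E).
  apply: ge0_le_integral => //.
  - by apply/measurable_EFinP; exact: measurable_norm_linear_error.
  - by apply: emeasurable_sum => i; exact: mg.
  - by move=> t _; rewrite /g sumEFin lee_fin; apply: (le_trans (ler_norm_sum _ _ _));
    apply: ler_sum => i _; rewrite normrM.
rewrite ge0_integral_sum//; last by move=> i t _; rewrite lee_fin mulr_ge0.
rewrite /total_weight mulr_suml -sumEFin; apply: lee_sum => i _.
rewrite /g; under eq_integral do rewrite EFinM.
rewrite ge0_integralZl//.
rewrite EFinM lee_wpmul2l ?lee_fin//.
apply: (@integral_product_law_coord_le _ _ _ i) => // t.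
under eq_integral do rewrite tnth_set_coord.
rewrite (@ge0_integral_unif_clamp _ (fun y => `|y|%:E))//.
  by rewrite integral_unif_norm.
exact/measurable_EFinP.
Qed.

Lemma mean_linear_error_fin : mean_linear_error \is a fin_num.
Proof.
rewrite ge0_fin_numE; first exact: le_lt_trans mean_linear_error_le (ltry _).
by apply: integral_ge0.
Qed.

Lemma integrable_norm_linear_error :
  (unif_law m).-integrable [set: m.-tuple RR] (fun t => `|S t|%:E).
Proof.
apply/integrableP; split.
  by apply/measurable_EFinP; exact: measurable_norm_linear_error.
under eq_integral do rewrite gee0_abs ?lee_fin//.
by rewrite -ge0_fin_numE ?mean_linear_error_fin//; apply: integral_ge0.
Qed.

Lemma SCC_atE delta : 0 <= delta ->
  SCC_at f j x delta = (\int[unif_law m]_t (ratio f j x delta t)%:E)%E.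
Proof.
move=> d0; apply: CP_expectationE => //.
by apply/measurable_EFinP; exact: measurable_error_ratio.
Qed.

Lemma cvg_SCC_at : SCC_at f j x delta @[delta --> 0^'+] --> mean_linear_error.
Proof.
rewrite -(fineK mean_linear_error_fin); apply: cvg_EFin_squeeze => e e0; near=> delta.
have delta0 : 0 < delta by near: delta; exact: nbhs_right_gt.
have H : forall t, `|ratio f j x delta t - (`|S t|)| <= e.
  by near: delta; exact: ratio_approx.
have mr : measurable_fun [set: m.-tuple RR] (ratio f j x delta).
  exact: measurable_ratio.
have mS := measurable_norm_linear_error.
rewrite SCC_atE ?(ltW delta0)// EFinB EFinD fineK ?mean_linear_error_fin//.
apply/andP; split.
  rewrite leeBlDr//; apply: integral_le_shift => //; first exact: ltW.
  - by move=> t; apply: ratio_ge0; exact: ltW.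
  - by move=> t; move: (H t); rewrite ler_norml; lra.
apply: integral_le_shift => //; first exact: ltW.
- by move=> t; apply: ratio_ge0; exact: ltW.
- by move=> t; move: (H t); rewrite ler_norml; lra.
Unshelve. all: by end_near. Qed.

Lemma SCLP_atE delta : 0 <= delta ->
  SCLP_at f j x delta =
  (\int[unif_law m]_t (lne (ratio f j x delta t)%:E * (ln 2)^-1%:E))%E.
Proof.
move=> d0; apply: CP_expectationE => //; apply: emeasurable_funM => //.
by apply: (measurableT_comp measurable_lne); exact: measurable_error_ratio.
Qed.

Lemma SCC_E : SCC f j x = mean_linear_error.
Proof. exact/cvg_lim/cvg_SCC_at. Qed.

End WorstCaseAndMean.

(** * Control of the singularity of the logarithm *)
Section MeanInverseSquareRoot.
Context {R : realType} {m : nat}.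
Local Notation RR := (measurableTypeR R).

(** Let [u0] minimize [`|phi|] along coordinate [i].  Since
    [k * `|a - u0| <= `|phi a| + `|phi u0| <= 2 * `|phi a|], the inverse square
    root of [phi] is dominated by that of [k / 2 * (a - u0)], whose mean is
    bounded independently of [u0]. *)
Lemma mean_inv_sqrt_le (phi : m.-tuple RR -> R) (i : 'I_m) (k : R) : 0 < k ->
  measurable_fun [set: m.-tuple RR] phi ->
  (forall t, exists2 h : R -> R, continuous h &
    forall a, -1 <= a <= 1 -> phi (set_coord i a t) = h a) ->
  (forall t (a b : R), -1 <= a <= 1 -> -1 <= b <= 1 ->
    k * `|a - b| <= `|phi (set_coord i a t) - phi (set_coord i b t)|) ->
  (\int[unif_law m]_t inv_sqrt (phi t) <= (3 / Num.sqrt (k / 2))%:E)%E.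
Proof.
move=> k0 mphi cphi kphi.
have k20 : 0 < k / 2 by rewrite divr_gt0.
apply: (@integral_product_law_coord_le _ _ _ i).
- by apply: measurableT_comp => //; exact: measurable_inv_sqrt.
- by move=> t; exact: inv_sqrt_ge0.
move=> t.
have [u0 u01 umin] : exists2 u0, u0 \in `[-1, 1]%R &
    forall a, a \in `[-1, 1]%R ->
      `|phi (set_coord i u0 t)| <= `|phi (set_coord i a t)|.
  have [h ch hE] := cphi t.
  have [||u0 u01 umin] := @EVT_min R (fun a => `|h a|) (-1) 1.
  - lra.
  - by apply: continuous_subspaceT => a; apply: cvg_norm; exact: ch.
  - by exists u0 => // a a1; rewrite !hE ?umin// -in_itv.
have mset : measurable_fun [set: RR] (fun a => set_coord i a t).
  apply/measurable_fun_tnthP => l.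
  rewrite (_ : _ \o _ = fun a => if l == i then a else tnth t l).
    by case: eqVneq => _.
  by apply/funext => a /=; rewrite tnth_mktuple.
have mint : measurable_fun [set: RR] (fun a => inv_sqrt (phi (set_coord i a t))).
  apply: measurableT_comp; first exact: measurable_inv_sqrt.
  exact: measurableT_comp.
have mu0 : measurable_fun [set: RR] (fun a => inv_sqrt (- u0 + a)).
  apply: measurableT_comp; first exact: measurable_inv_sqrt.
  by apply: continuous_measurable_fun; exact: continuous_shift.
apply: (@le_trans _ _ (\int[unif]_a (((Num.sqrt (k / 2))^-1)%:E * inv_sqrt (- u0 + a)))%E).
  rewrite !ge0_integral_unif//; last 3 first.
  - exact: measurable_funeM.
  - by move=> a; rewrite mule_ge0 ?inv_sqrt_ge0// lee_fin invr_ge0 sqrtr_ge0.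
  - by move=> a; exact: inv_sqrt_ge0.
  rewrite lee_wpmul2l ?lee_fin ?invr_ge0//.
  apply: ge0_le_integral => //.
  - by move=> a _; exact: inv_sqrt_ge0.
  - exact: measurable_funTS.
  - by apply: measurable_funTS; exact: measurable_funeM.
  move=> a; rewrite /= in_itv/= => a1; apply: inv_sqrt_le => //.
  have /umin min_a : a \in `[-1, 1]%R by rewrite in_itv.
  rewrite in_itv/= in u01.
  have := kphi t _ _ a1 u01.
  have := ler_normB (phi (set_coord i a t)) (phi (set_coord i u0 t)).
  rewrite (addrC (- u0)); lra.
rewrite ge0_integralZl//; last by move=> a _; exact: inv_sqrt_ge0.
rewrite (mulrC 3) EFinM lee_wpmul2l ?lee_fin ?invr_ge0 ?sqrtr_ge0//.
by apply: integral_inv_sqrt_le; rewrite in_itv/= in u01; rewrite ler_norml.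
Qed.

End MeanInverseSquareRoot.

Section LogBounds.
Context {R : realType}.
Implicit Types (s rho eta tau : R).

Lemma inv_sqrt_neq0 s : s != 0 -> inv_sqrt s = ((Num.sqrt `|s|)^-1)%:E.
Proof. by rewrite /inv_sqrt => /negbTE ->. Qed.

Lemma inv_sqrt0 : inv_sqrt (0 : R) = +oo%E.
Proof. by rewrite /inv_sqrt eqxx. Qed.

(** With [z = s / tau^2], the difference of [pot z] and [ln `|z| + 1] is at
    most [1/2 ln (1 + 1 / z^2)], and
    [1 + y^4 <= (1 + y)^4] for [y = `|z|^(-1/2)] bounds this by [2 y]. *)
Lemma pot_le_ln tau s : 0 < tau ->
  ((pot (s / tau ^+ 2) + (2 * ln tau - 1))%:E - (2 * tau)%:E * inv_sqrt s
    <= lne `|s|%:E)%E.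
Proof.
move=> tau0; have [->|s0] := eqVneq s 0.
  by rewrite inv_sqrt0 gt0_muley ?lte_fin ?mulr_gt0// addeNy leNye.
have n0 : 0 < `|s| by rewrite normr_gt0.
rewrite inv_sqrt_neq0// lne_EFin// -EFinM -EFinB lee_fin.
set y := tau / Num.sqrt `|s|.
have q0 : 0 < Num.sqrt `|s| by rewrite sqrtr_gt0.
have y0 : 0 < y by rewrite divr_gt0.
have -> : 2 * tau * (Num.sqrt `|s|)^-1 = 2 * y by rewrite /y mulrA.
set z := s / tau ^+ 2.
have t20 : 0 < tau ^+ 2 by rewrite exprn_gt0.
have z0 : 0 < `|z| by rewrite normr_gt0 mulf_neq0// invr_neq0// gt_eqF.
have zE : `|z| = `|s| / tau ^+ 2 by rewrite normrM normfV (gtr0_norm t20).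
have lnz : ln `|z| = ln `|s| - 2 * ln tau.
  by rewrite zE ln_div ?posrE// lnXn// mulr_natl.
have z2 : 0 < z ^+ 2 by rewrite -real_normK ?num_real// exprn_gt0.
have z2E : 1 + z ^+ 2 = `|z| ^+ 2 * (1 + y ^+ 4).
  have -> : y ^+ 4 = (`|z| ^+ 2)^-1.
    have sq : `|s| = Num.sqrt `|s| ^+ 2 by rewrite sqr_sqrtr.
    rewrite zE /y; move: q0 sq; set q := Num.sqrt _ => q0 ->.
    by field; rewrite !gt_eqF.
  rewrite mulrDr mulr1 mulfV ?gt_eqF ?exprn_gt0// real_normK ?num_real//.
  by rewrite addrC.
have y4 : 0 < 1 + y ^+ 4 by rewrite addr_gt0// exprn_gt0.
have L1 : 2^-1 * ln (1 + z ^+ 2) = ln `|z| + 2^-1 * ln (1 + y ^+ 4).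
  rewrite z2E lnM ?posrE ?exprn_gt0// lnXn// -(mulr_natl (ln _)) mulrDr mulKf//.
have y1 : 0 < 1 + y by rewrite addr_gt0.
have L2 : ln (1 + y ^+ 4) <= 4 * y.
  apply: (@le_trans _ _ (ln ((1 + y) ^+ 4))).
    rewrite ler_ln ?posrE ?exprn_gt0//.
    have h2 := mulr_gt0 y0 y0.
    have h3 := mulr_gt0 h2 y0.
    have -> : (1 + y) ^+ 4 = 1 + 4 * y + 6 * (y * y) + 4 * (y * y * y) + y ^+ 4 by ring.
    lra.
  by rewrite lnXn// -(mulr_natl (ln _)) ler_wpM2l// ln_1Dx_le// ltW.
have L3 : z ^+ 2 / (1 + z ^+ 2) <= 1.
  by rewrite ler_pdivrMr ?mul1r; lra.
rewrite /pot L1 lnz; lra.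
Qed.

(** Writing [y = eta / Num.sqrt s], one has
    [rho <= s + eta^2 <= s (1 + y)^2], hence [ln rho <= ln s + 2 y].  The
    correction is subtracted on the left so that at [s = 0] both sides are
    [-oo]. *)
Lemma lne_close rho s eta : 0 <= rho -> 0 <= s -> 0 <= eta ->
  `|rho - s| <= eta ^+ 2 ->
  (lne rho%:E - (2 * eta)%:E * inv_sqrt s <= lne s%:E)%E.
Proof.
move=> rho0 s0 eta0 rs.
have lne0 : lne (0 : R)%:E = -oo%E by apply: le0_lneNy.
move: s0; rewrite le_eqVlt => /predU1P[s0|s0].
  rewrite -s0 lne0 inv_sqrt0.
  move: eta0; rewrite le_eqVlt => /predU1P[eta0|eta0].
    have -> : rho = 0.
      apply/eqP; rewrite -normr_le0; move: rs.
      by rewrite -s0 -eta0 expr0n subr0.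
    by rewrite lne0 -eta0 mulr0 mul0e sube0.
  by rewrite gt0_muley ?lte_fin ?mulr_gt0// addeNy.
move: rho0; rewrite le_eqVlt => /predU1P[<-|rho0].
  by rewrite lne0 addNye leNye.
rewrite inv_sqrt_neq0 ?gt_eqF// !lne_EFin// -EFinM -EFinB lee_fin (gtr0_norm s0).
have q0 : 0 < Num.sqrt s by rewrite sqrtr_gt0.
set y := eta / Num.sqrt s.
have y0 : 0 <= y by rewrite divr_ge0// ltW.
have -> : 2 * eta * (Num.sqrt s)^-1 = 2 * y by rewrite /y mulrA.
have y1 : 0 < 1 + y by rewrite ltr_wpDr.
have : ln rho <= ln (s * (1 + y) ^+ 2).
  rewrite ler_ln ?posrE ?mulr_gt0 ?exprn_gt0//.
  have -> : s * (1 + y) ^+ 2 = s + 2 * (s * y) + eta ^+ 2.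
    have -> : eta ^+ 2 = s * y ^+ 2.
      rewrite /y expr_div_n sqr_sqrtr ?(ltW s0)//.
      by field; rewrite gt_eqF.
    by ring.
  have := mulr_ge0 (ltW s0) y0; move: rs; rewrite ler_norml; lra.
rewrite lnM ?posrE ?exprn_gt0// lnXn// -(mulr_natl (ln (1 + y))).
have := ln_1Dx_le y0; lra.
Qed.

Lemma abs_lne_le s : 0 <= s ->
  (`|lne s%:E| <= s%:E + 2%:E * inv_sqrt s)%E.
Proof.
rewrite le_eqVlt => /predU1P[<-|s0].
  by rewrite inv_sqrt0 gt0_muley ?lte_fin// addey// leey.
rewrite inv_sqrt_neq0 ?gt_eqF// lne_EFin// -EFinM -EFinD /= lee_fin (gtr0_norm s0).
have q0 : 0 < Num.sqrt s by rewrite sqrtr_gt0.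
have h1 : ln s <= s by apply/ltW/ln_sublinear.
have h2 : - ln s <= 2 * (Num.sqrt s)^-1.
  have -> : - ln s = 2 * ln (Num.sqrt s)^-1.
    rewrite lnV ?posrE// -[in LHS](@sqr_sqrtr _ s) ?(ltW s0)// lnXn// -mulr_natl; ring.
  by rewrite ler_wpM2l//; apply/ltW/ln_sublinear; rewrite invr_gt0.
have h3 : 0 <= (Num.sqrt s)^-1 by rewrite invr_ge0 ltW.
rewrite ler_norml; lra.
Qed.

(** The tangent at [c] is above the graph, by concavity. *)
Lemma lne_le_tangent c s : 0 < c -> 0 <= s ->
  (lne s%:E <= (s / c + (ln c - 1))%:E)%E.
Proof.
move=> c0; rewrite le_eqVlt => /predU1P[<-|s0].
  by rewrite le0_lneNy// leNye.
rewrite lne_EFin// lee_fin.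
have sc0 : 0 < s / c by rewrite divr_gt0.
have : ln (s / c) <= s / c - 1.
  have := @le_ln1Dx R (s / c - 1); rewrite subrKC; apply; lra.
rewrite ln_div ?posrE//; lra.
Qed.

End LogBounds.

Section LogIntegrals.
Context d (T : measurableType d) {R : realType} (P : probability T R).
Implicit Types (g h : T -> R).
Local Open Scope ereal_scope.

Lemma integrable_inv_sqrt g : measurable_fun [set: T] g ->
  \int[P]_t inv_sqrt (g t) < +oo ->
  P.-integrable [set: T] (fun t => inv_sqrt (g t)).
Proof.
move=> mg gfin; apply/integrableP; split.
  by apply: measurableT_comp => //; exact: measurable_inv_sqrt.
by under eq_integral do rewrite gee0_abs ?inv_sqrt_ge0//.
Qed.

Lemma integrable_lne g (B : R) : measurable_fun [set: T] g ->
  (forall t, (0 <= g t <= B)%R) -> \int[P]_t inv_sqrt (g t) < +oo ->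
  P.-integrable [set: T] (fun t => lne (g t)%:E).
Proof.
move=> mg gB gfin.
have iB : P.-integrable [set: T] (cst B%:E) by exact: finite_measure_integrable_cst.
have i2 := integrableZl measurableT 2%R (integrable_inv_sqrt mg gfin).
apply: (le_integrable measurableT _ _ (integrableD measurableT iB i2)).
  exact: measurableT_comp measurable_lne mg.
move=> t _; have /andP[g0 gle] := gB t.
have q0 : 0 <= 2%:E * inv_sqrt (g t) by rewrite mule_ge0 ?inv_sqrt_ge0.
have B0 : (0 <= B)%R by apply: le_trans gle.
rewrite [leRHS]gee0_abs; last by rewrite adde_ge0.
apply: (le_trans (abs_lne_le g0)).
by rewrite leeD2r// lee_fin.
Qed.

(** Uniformly close functions whose inverse square roots have bounded means
    have close mean logarithms. *)
Lemma integral_lne_close g h (B eta : R) (C : \bar R) :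
  measurable_fun [set: T] g -> measurable_fun [set: T] h ->
  (forall t, (0 <= g t <= B)%R) -> (forall t, (0 <= h t <= B)%R) ->
  (0 <= eta)%R -> (forall t, (`|g t - h t| <= eta ^+ 2)%R) ->
  \int[P]_t inv_sqrt (g t) < +oo -> \int[P]_t inv_sqrt (h t) < +oo ->
  \int[P]_t inv_sqrt (h t) <= C ->
  \int[P]_t lne (g t)%:E <= \int[P]_t lne (h t)%:E + (2 * eta)%:E * C.
Proof.
move=> mg mh gB hB eta0 gh gfin hfin hC.
have ig := integrable_lne mg gB gfin.
have ih := integrable_lne mh hB hfin.
have i2 := integrableZl measurableT (2 * eta)%R (integrable_inv_sqrt mh hfin).
have ifin := integrable_fin_num measurableT ig.
have hfin' : \int[P]_t inv_sqrt (h t) \is a fin_num.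
  by rewrite ge0_fin_numE// integral_ge0// => t _; exact: inv_sqrt_ge0.
apply: (@le_trans _ _ (\int[P]_t lne (h t)%:E + (2 * eta)%:E * \int[P]_t inv_sqrt (h t))).
  rewrite -leeBlDr; last by rewrite fin_numM.
  rewrite -integralZl//; last exact: integrable_inv_sqrt.
  rewrite -integralB//.
  apply: integral_mono.
  - by apply: emeasurable_funB; [exact: measurable_int ig|exact: measurable_int i2].
  - exact: measurable_int ih.
  - move=> t; have /andP[g0 _] := gB t; have /andP[h0 _] := hB t.
    exact: lne_close.
by rewrite leeD2l// lee_wpmul2l// lee_fin mulr_ge0.
Qed.

End LogIntegrals.

Section DerivativeAlongLine.
Context {R : realType} {m n : nat}.
Variables (f : 'rV[R]_m -> 'rV[R]_n) (j : 'I_n).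
Hypothesis hf : forall y : 'rV[R]_m, differentiable f y.

(** The difference quotients of the restriction to the line are the [j]-th
    coordinates of those of the directional derivative. *)
Lemma is_derive_line (p v : 'rV[R]_m) (a : R) :
  is_derive a 1 (fun b : R => f (p + b *: v) 0 j)
    ((v *m 'J f (p + a *: v)) 0 j).
Proof.
set q := p + a *: v.
have D : derivable f q v by exact: diff_derivable.
have E : (fun h : R => h^-1 *: (((fun b : R => f (p + b *: v) 0 j) \o shift a) (h *: 1)
      - f (p + a *: v) 0 j)) =
    (fun z : 'rV[R]_n => z 0 j) \o
    (fun h : R => h^-1 *: ((f \o shift q) (h *: v) - f q)).
  apply/funext => h /=; rewrite !mxE; congr (_ * (f _ 0 j - _)).
  by rewrite /q [h *: 1]mulr1 scalerDl addrCA.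
have C : (fun h : R => h^-1 *: (((fun b : R => f (p + b *: v) 0 j) \o shift a) (h *: 1)
      - f (p + a *: v) 0 j)) @ 0^' --> ((v *m 'J f q) 0 j).
  rewrite E; apply: continuous_cvg; first exact: coord_continuous.
  by rewrite -deriveEjacobian.
apply: DeriveDef.
  by apply/cvg_ex; exists ((v *m 'J f q) 0 j).
exact/cvg_lim/C.
Qed.

End DerivativeAlongLine.

Section Slopes.
Context {R : realType} {m n : nat}.
Local Notation RR := (measurableTypeR R).
Variables (f : 'rV[R]_m -> 'rV[R]_n) (j : 'I_n) (x : 'rV[R]_m).
Hypothesis hf : forall y : 'rV[R]_m, differentiable f y.
Hypothesis fx0 : f x 0 j != 0.
Variable i : 'I_m.
Let w := weight f j x.
Let S := linear_error f j x.

Lemma linear_error_set_coord (t : m.-tuple RR) (a : R) : -1 <= a <= 1 ->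
  S (set_coord i a t) = S (set_coord i 0 t) + w i * a.
Proof.
move=> a1; rewrite /S /linear_error (bigD1 i)//= [in RHS](bigD1 i)//=.
rewrite !tnth_set_coord clampK// clampK; last lra.
rewrite mulr0 add0r addrC; congr (_ + _).
by apply: eq_bigr => k /negbTE ki; rewrite !tnth_mktuple ki.
Qed.

Lemma mean_inv_sqrt_linear_error : w i != 0 ->
  (\int[unif_law m]_t inv_sqrt (S t) <= (3 / Num.sqrt (`|w i| / 2))%:E)%E.
Proof.
move=> w0; apply: (@mean_inv_sqrt_le _ _ _ i).
- by rewrite normr_gt0.
- exact: measurable_linear_error.
- move=> t; exists (fun a => S (set_coord i 0 t) + w i * a).
    exact: continuous_affine.
  exact: linear_error_set_coord.
- move=> t a b a1 b1; rewrite (linear_error_set_coord t a1) (linear_error_set_coord t b1) -normrM.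
  by rewrite (_ : S _ + _ - _ = w i * (a - b))//; ring.
Qed.

(** Without the absolute value the error is monotone along a coordinate, and
    [inv_sqrt] does not see the sign. *)
Definition signed_ratio (delta : R) (t : m.-tuple RR) : R :=
  (f (perturb x delta t) 0 j - f x 0 j) / (delta * `|f x 0 j|).

Lemma norm_signed_ratio delta t : 0 <= delta ->
  `|signed_ratio delta t| = ratio f j x delta t.
Proof.
move=> d0; rewrite normrM normfV [X in _ / X]ger0_norm//.
by rewrite mulr_ge0.
Qed.

Lemma perturb_set_coord delta t (a : R) : -1 <= a <= 1 ->
  perturb x delta (set_coord i a t) =
  perturb x delta (set_coord i 0 t) + a *: (delta * `|x 0 i| *: delta_mx 0 i).
Proof.
move=> a1; apply/rowP => k; rewrite !mxE !tnth_mktuple eqxx /=.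
case: eqVneq => [->|ki]; last by rewrite !mulr0 addr0.
rewrite clampK// clampK; last lra.
by rewrite mulr0 addr0 mulr1 mulrC.
Qed.

Hypothesis cJ : {for x, continuous (fun y => 'J f y i j)}.
Hypothesis w0 : w i != 0.

Let path delta t (a : R) := perturb x delta (set_coord i 0 t) +
  a *: (delta * `|x 0 i| *: delta_mx 0 i).

(** This is where the continuity of the partial derivative at [x] is used:
    the whole box lies in the ball where it differs from its value at [x] by at
    most a half. *)
Lemma slope_near : \forall delta \near 0^'+, forall t (a : R), -1 <= a <= 1 ->
  `|'J f (path delta t a) i j - 'J f x i j| <= `|'J f x i j| / 2.
Proof.
have J0 : 0 < `|'J f x i j| / 2.
  rewrite divr_gt0// normr_gt0; apply: contra_neq w0 => J0.
  by rewrite /w /weight J0 !mul0r.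
have /cvgrPdist_le/(_ _ J0)/nbhs_normP[d /= d0 H] := cJ.
near=> delta => t a a1.
have delta0 : 0 < delta by near: delta; exact: nbhs_right_gt.
have x10 : 0 < `|x| + 1 by rewrite ltr_wpDl.
have delta1 : delta * (`|x| + 1) < d.
  rewrite -ltr_pdivlMr//; near: delta; apply: nbhs_right_lt.
  by rewrite divr_gt0.
rewrite distrC; apply: H; rewrite /path -perturb_set_coord// /ball_/=.
apply: le_lt_trans delta1; apply: mx_norm_le => [|k].
  by rewrite mulr_ge0// ltW.
rewrite !mxE opprD addNKr normrN normrM ger0_norm ?mulr_ge0 ?(ltW delta0)//.
apply: (@le_trans _ _ (delta * `|x 0 k|)).
  by rewrite ler_piMr ?norm_clamp_le1// mulr_ge0// ltW.
rewrite ler_wpM2l ?(ltW delta0)// (le_trans (le_mx_norm x k))// lerDl//.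
Unshelve. all: by end_near. Qed.

(** By the mean value theorem and [slope_near], the slope of the rescaled
    signed error along coordinate [i] is at least half of [`|w i|]. *)
Lemma mean_inv_sqrt_ratio : \forall delta \near 0^'+,
  (\int[unif_law m]_t inv_sqrt (ratio f j x delta t) <=
    (3 / Num.sqrt (`|w i| / 2 / 2))%:E)%E.
Proof.
near=> delta.
have delta0 : 0 < delta by near: delta; exact: nbhs_right_gt.
have H : forall t (a : R), -1 <= a <= 1 ->
    `|'J f (path delta t a) i j - 'J f x i j| <= `|'J f x i j| / 2.
  by near: delta; exact: slope_near.
have dg0 : 0 < delta * `|f x 0 j| by rewrite mulr_gt0 ?normr_gt0.
have -> : (\int[unif_law m]_t inv_sqrt (ratio f j x delta t) =
    \int[unif_law m]_t inv_sqrt (signed_ratio delta t))%E.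
  apply: eq_integral => t _; rewrite -norm_signed_ratio ?(ltW delta0)//.
  by rewrite /inv_sqrt normr_eq0 normr_id.
pose v : 'rV[R]_m := delta * `|x 0 i| *: delta_mx 0 i.
have Dp t (a : R) := is_derive_line j hf (perturb x delta (set_coord i 0 t)) v a.
have vJ t a : (v *m 'J f (path delta t a)) 0 j =
    delta * `|x 0 i| * 'J f (path delta t a) i j.
  by rewrite /v -scalemxAl mxE -rowE mxE.
have cp t : continuous (fun a : R => f (path delta t a) 0 j).
  by move=> a; exact: (is_derive_continuous (Dp t a)).
apply: (@mean_inv_sqrt_le _ _ _ i).
- by rewrite divr_gt0// normr_gt0.
- apply: (@measurable_perturb _ _ _ _ _ _ (fun y => (f y 0 j - f x 0 j) / (delta * `|f x 0 j|))).
  apply: measurable_continuous_row => y.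
  apply: (@continuous_comp _ _ _ (fun z => f z 0 j)
    (fun u : R => (u - f x 0 j) / (delta * `|f x 0 j|))).
    apply: (@continuous_comp _ _ _ f (fun z : 'rV[R]_n => z 0 j)).
      exact/differentiable_continuous.
    exact: coord_continuous.
  apply: cvgM; last exact: cvg_cst.
  by apply: cvgB; [exact: cvg_id|exact: cvg_cst].
- move=> t.
  exists (fun a => (f (path delta t a) 0 j - f x 0 j) / (delta * `|f x 0 j|)).
    move=> a; apply: cvgM; last exact: cvg_cst.
    by apply: cvgB; [exact: cp|exact: cvg_cst].
  by move=> a a1; rewrite /signed_ratio perturb_set_coord.
have main t (a b : R) : -1 <= a <= 1 -> -1 <= b <= 1 -> a <= b ->
    `|w i| / 2 * `|b - a| <=
    `|signed_ratio delta (set_coord i b t) - signed_ratio delta (set_coord i a t)|.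
  move=> a1 b1 ab.
  rewrite /signed_ratio (perturb_set_coord _ _ a1) (perturb_set_coord _ _ b1).
  rewrite -/(path delta t a) -/(path delta t b).
  rewrite -mulrBl opprB addrA subrK.
  have [c cab ->] := MVT_segment ab (fun c _ => Dp t c) (continuous_subspaceT (cp t)).
  have c1 : -1 <= c <= 1 by move: cab; rewrite in_itv/=; lra.
  rewrite -/(path delta t c) vJ.
  rewrite [in leRHS]normrM normfV (gtr0_norm dg0) ![in leRHS]normrM normr_id (gtr0_norm delta0).
  have -> : `|w i| = `|'J f x i j| * `|x 0 i| / `|f x 0 j|.
    by rewrite /w /weight !normrM normfV !normr_id.
  have Jc : `|'J f x i j| / 2 <= `|'J f (path delta t c) i j|.
    have half (p q : R) : `|q - p| <= `|p| / 2 -> `|p| / 2 <= `|q|.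
      by have := ler_normD q (p - q); rewrite (addrC q) subrK (distrC p); lra.
    exact: half (H t c c1).
  have rescale (A A' X G B : R) : A / 2 <= A' -> 0 <= X -> 0 < G -> 0 <= B ->
      A * X / G / 2 * B <= delta * X * A' * B / (delta * G).
    move=> AA X0 G0 B0.
    have -> : A * X / G / 2 * B = (A / 2) * (X / G * B) by field; rewrite gt_eqF.
    have -> : delta * X * A' * B / (delta * G) = A' * (X / G * B).
      by field; rewrite !gt_eqF.
    by rewrite ler_wpM2r// mulr_ge0// divr_ge0// ltW.
  by apply: rescale; rewrite ?normr_gt0.
move=> t a b a1 b1; have [ab|/ltW ab] := leP a b.
  by rewrite (distrC a) (distrC (signed_ratio _ _)); exact: main.
exact: main.
Unshelve. all: by end_near. Qed.

End Slopes.

(** * The mean logarithm *)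
Section MeanLog.
Context {R : realType} {m n : nat}.
Local Notation RR := (measurableTypeR R).
Variables (f : 'rV[R]_m -> 'rV[R]_n) (j : 'I_n) (x : 'rV[R]_m).
Hypothesis hf : forall y : 'rV[R]_m, differentiable f y.
Hypothesis fx0 : f x 0 j != 0.
Let w := weight f j x.
Let S := linear_error f j x.

Definition mean_log : \bar R := (\int[unif_law m]_t lne `|S t|%:E)%E.

Let inv_sqrt_norm (s : R) : inv_sqrt `|s| = inv_sqrt s.
Proof. by rewrite /inv_sqrt normr_eq0 normr_id. Qed.

Let mS : measurable_fun [set: m.-tuple RR] (fun t => `|S t|).
Proof. exact: measurable_norm_linear_error. Qed.

Let Sbound t : 0 <= `|S t| <= total_weight f j x.
Proof. by rewrite normr_ge0/=; exact: linear_error_le. Qed.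

Variable i : 'I_m.
Hypothesis w0 : w i != 0.

Let C : R := 3 / Num.sqrt (`|w i| / 2).

Let C0 : 0 <= C.
Proof. by rewrite divr_ge0// sqrtr_ge0. Qed.

Let SC : (\int[unif_law m]_t inv_sqrt `|S t| <= C%:E)%E.
Proof.
under eq_integral do rewrite inv_sqrt_norm.
exact: mean_inv_sqrt_linear_error.
Qed.

Let Sfin : (\int[unif_law m]_t inv_sqrt `|S t| < +oo)%E.
Proof. exact: le_lt_trans SC (ltry _). Qed.

Lemma mean_log_fin : mean_log \is a fin_num.
Proof.
by apply: integrable_fin_num => //; exact: integrable_lne mS Sbound Sfin.
Qed.

Lemma pot_linear_error_ge (k : R) :
  ((2^-1 * ln (1 + (\sum_(l < m) (k * w l) ^+ 2) / 3))%:E <=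
   \int[unif_law m]_t (pot (k * S t))%:E)%E.
Proof.
apply: (le_trans (pot_lin_ge (fun l => k * w l))).
rewrite /unif_law (@ge0_integral_product_law_map _ _ _ (fun=> unif) (fun=> @clamp R)).
- rewrite le_eqVlt; apply/orP; left; apply/eqP; apply: eq_integral => t _.
  congr (pot _)%:E; rewrite /S /linear_error mulr_sumr; apply: eq_bigr => l _.
  by rewrite tnth_mktuple mulrA.
- by move=> _; exact: measurable_clamp.
- by move=> _ g mg g0; rewrite ge0_integral_unif_clamp.
- apply/measurable_EFinP; apply: measurableT_comp; last exact: measurable_lin.
  by apply: continuous_measurable_fun; exact: continuous_pot.
- by move=> t; rewrite lee_fin pot_ge0.
Qed.

Let V : R := \sum_(l < m) w l ^+ 2.

Let V0 : 0 < V.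
Proof.
rewrite /V (bigD1 i)//=; apply: ltr_pwDl.
  by rewrite exprn_even_gt0.
by apply: sumr_ge0 => l _; exact: sqr_ge0.
Qed.

(** [pot_linear_error_ge] at scale [1 / tau^2], transferred by [pot_le_ln]. The
    [tau^4] coming from [1 +] under the logarithm is dropped. *)
Lemma mean_log_ge_eps (tau : R) : 0 < tau ->
  ((2^-1 * ln (V / 3) - 1 - 2 * tau * C)%:E <= mean_log)%E.
Proof.
move=> tau0; pose k := (tau ^+ 2)^-1; pose c := 2 * ln tau - 1.
have mpot : measurable_fun [set: m.-tuple RR] (fun t => pot (k * S t)).
  apply: (@measurableT_comp _ _ _ _ _ _ (@pot R)).
    by apply: continuous_measurable_fun; exact: continuous_pot.
  by apply: measurable_funM => //; exact: measurable_linear_error.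
have ipot : (unif_law m).-integrable [set: m.-tuple RR] (fun t => (pot (k * S t))%:E).
  apply: (@le_integrable _ _ _ _ _ _ _ (cst ((k * total_weight f j x) ^+ 2 + 1)%:E)) => //.
  - exact/measurable_EFinP.
  - move=> t _ /=; rewrite lee_fin (ger0_norm (pot_ge0 _)) ger0_norm; last first.
      by rewrite addr_ge0// sqr_ge0.
    apply: (le_trans (pot_le _)); rewrite lerD2r.
    have h : `|k * S t| <= k * total_weight f j x.
      rewrite normrM ger0_norm ?invr_ge0 ?sqr_ge0// ler_wpM2l ?invr_ge0 ?sqr_ge0//.
      exact: linear_error_le.
    rewrite -[leLHS]real_normK ?num_real//.
    by apply: lerXn2r; rewrite ?nnegrE//; exact: le_trans h.
  - exact: finite_measure_integrable_cst.
have ic : (unif_law m).-integrable [set: m.-tuple RR] (cst c%:E).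
  exact: finite_measure_integrable_cst.
have ipsi := integrable_inv_sqrt mS Sfin.
have ipsi2 := integrableZl measurableT (2 * tau) ipsi.
have ipc := integrableD measurableT ipot ic.
apply: (@le_trans _ _ (\int[unif_law m]_t
   (((pot (k * S t))%:E + c%:E) - (2 * tau)%:E * inv_sqrt `|S t|))%E); last first.
  apply: integral_mono.
  - by apply: emeasurable_funB; [exact: measurable_int ipc|exact: measurable_int ipsi2].
  - exact: measurableT_comp measurable_lne mS.
  - by move=> t; rewrite inv_sqrt_norm -EFinD (mulrC k); exact: pot_le_ln.
rewrite integralB// integralD// integralZl// integral_cst//.
rewrite [X in (_ + _ * X - _)%E]probability_setT mule1.
apply: (@le_trans _ _ ((2^-1 * ln (1 + (\sum_(l < m) (k * w l) ^+ 2) / 3))%:E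
   + c%:E - (2 * tau)%:E * C%:E)%E); last first.
  apply: leeB; first by rewrite leeD2r// pot_linear_error_ge.
  by rewrite lee_wpmul2l// lee_fin mulr_ge0// ltW.
suff : 2^-1 * ln (V / 3) <=
    2^-1 * ln (1 + (\sum_(l < m) (k * w l) ^+ 2) / 3) + 2 * ln tau.
  by rewrite -EFinM -!EFinD lee_fin /c; lra.
have t4 : 0 < tau ^+ 4 by rewrite exprn_gt0.
have -> : \sum_(l < m) (k * w l) ^+ 2 = V / tau ^+ 4.
  rewrite /V mulr_suml; apply: eq_bigr => l _; rewrite /k.
  by field; rewrite gt_eqF.
have -> : 2 * ln tau = 2^-1 * ln (tau ^+ 4).
  by rewrite lnXn// -(mulr_natl (ln _)) mulrA; congr (_ * _); lra.
have p : 0 < 1 + V / tau ^+ 4 / 3 by rewrite addr_gt0// !divr_gt0.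
rewrite -mulrDr -lnM ?posrE// ler_wpM2l// ?invr_ge0// ler_ln ?posrE ?divr_gt0 ?mulr_gt0//.
rewrite [leRHS](_ : _ = V / 3 + tau ^+ 4); last by field; rewrite gt_eqF.
by rewrite lerDl ltW.
Qed.

(** The limit [tau -> 0] of [mean_log_ge_eps]. *)
Lemma mean_log_ge : ((2^-1 * ln (V / 3) - 1)%:E <= mean_log)%E.
Proof.
have := mean_log_ge_eps; rewrite -(fineK mean_log_fin) => H.
rewrite lee_fin; apply/ler_addgt0Pr => e e0.
have D0 : 0 < 2 * C + 1 by rewrite ltr_wpDl// mulr_ge0.
have := H (e / (2 * C + 1)) (divr_gt0 e0 D0); rewrite lee_fin.
have : 2 * (e / (2 * C + 1)) * C <= e.
  rewrite [leLHS](_ : _ = e * (2 * C) / (2 * C + 1)); last by field; rewrite gt_eqF.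
  by rewrite ler_pdivrMr// ler_wpM2l ?(ltW e0)// lerDl.
lra.
Qed.

Hypothesis cJ : {for x, continuous (fun y => 'J f y i j)}.

Let meas_ratio delta : measurable_fun [set: m.-tuple RR] (ratio f j x delta).
Proof. exact: measurable_ratio. Qed.

(** [integral_lne_close] applied in both directions between the error and its
    linearization; [eta] is chosen so that the two corrections are at
    most [e * ln 2]. *)
Lemma cvg_SCLP_at :
  SCLP_at f j x delta @[delta --> 0^'+] --> (fine mean_log / ln 2)%:E.
Proof.
have ln20 : 0 < ln 2 :> R by apply: ln_gt0; lra.
pose C' : R := 3 / Num.sqrt (`|w i| / 2 / 2).
have C'0 : 0 <= C' by rewrite divr_ge0// sqrtr_ge0.
apply: cvg_EFin_squeeze => e e0.
pose eta := e * ln 2 / (2 * (C + C') + 1).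
have D0 : 0 < 2 * (C + C') + 1 by rewrite ltr_wpDl// mulr_ge0// addr_ge0.
have eta0 : 0 < eta by rewrite divr_gt0// mulr_gt0.
have etaC c : 0 <= c <= C + C' -> 2 * eta * c <= e * ln 2.
  move=> /andP[c0 cC]; rewrite /eta [leLHS](_ : _ = e * ln 2 * (2 * c) / (2 * (C + C') + 1)).
    rewrite ler_pdivrMr// ler_wpM2l ?mulr_ge0 ?(ltW e0) ?(ltW ln20)//; lra.
  by field; rewrite gt_eqF.
have eta20 : 0 < eta ^+ 2 by rewrite exprn_gt0.
near=> delta.
have delta0 : 0 < delta by near: delta; exact: nbhs_right_gt.
have H : forall t, `|ratio f j x delta t - (`|S t|)| <= eta ^+ 2.
  by near: delta; exact: ratio_approx.
have RC : (\int[unif_law m]_t inv_sqrt (ratio f j x delta t) <= C'%:E)%E.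
  by near: delta; exact: mean_inv_sqrt_ratio.
have Rfin : (\int[unif_law m]_t inv_sqrt (ratio f j x delta t) < +oo)%E.
  exact: le_lt_trans RC (ltry _).
pose B := total_weight f j x + eta ^+ 2.
have SB t : 0 <= `|S t| <= B.
  by have /andP[-> h] := Sbound t; rewrite /= /B; lra.
have RB t : 0 <= ratio f j x delta t <= B.
  rewrite ratio_ge0 ?(ltW delta0)//=; have /andP[_ h] := Sbound t.
  by move: (H t); rewrite ler_norml /B; lra.
have H' t : `|(`|S t|) - ratio f j x delta t| <= eta ^+ 2 by rewrite distrC.
have h1 := integral_lne_close (meas_ratio delta) mS RB SB (ltW eta0) H Rfin Sfin SC.
have h2 := integral_lne_close mS (meas_ratio delta) SB RB (ltW eta0) H' Sfin Rfin RC.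
have iR := integrable_lne (meas_ratio delta) RB Rfin.
have fR := integrable_fin_num measurableT iR.
rewrite SCLP_atE ?(ltW delta0)// integralZr//.
move: h1 h2; rewrite -/mean_log -(fineK mean_log_fin) -(fineK fR) -!EFinM -!EFinD !lee_fin.
set a := fine mean_log; set b := fine _ => h1 h2.
have c1 : 2 * eta * C <= e * ln 2 by apply: etaC; rewrite C0/= lerDl.
have c2 : 2 * eta * C' <= e * ln 2 by apply: etaC; rewrite C'0/= lerDr.
have eE : e = e * ln 2 / ln 2 by rewrite mulfK// gt_eqF.
rewrite /= eE; apply/andP; split.
  by rewrite lerBlDr -mulrDl ler_wpM2r ?invr_ge0 ?(ltW ln20)//; lra.
by rewrite -mulrDl ler_wpM2r ?invr_ge0 ?(ltW ln20)//; lra.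
Unshelve. all: by end_near. Qed.

Lemma SCLP_E : SCLP f j x = (fine mean_log / ln 2)%:E.
Proof. exact/cvg_lim/cvg_SCLP_at. Qed.

End MeanLog.

(** * The bounds *)
Section FinalInequalities.
Context {R : realType} {m n : nat}.
Local Notation RR := (measurableTypeR R).
Variables (f : 'rV[R]_m -> 'rV[R]_n) (j : 'I_n) (x : 'rV[R]_m).
Hypothesis hf : forall y : 'rV[R]_m, differentiable f y.
Hypothesis fx0 : f x 0 j != 0.
Hypothesis m1 : (1 < m)%N.
Let w := weight f j x.
Let S := linear_error f j x.
Let W := total_weight f j x.
Hypothesis W0 : 0 < W.

Let mr_gt1 : 1 < m%:R :> R.
Proof. by rewrite ltr1n. Qed.

Let mB1 : 0 < m%:R - 1 :> R.
Proof. by rewrite subr_gt0. Qed.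

(** Cauchy-Schwarz, as the nonnegativity of the variance of the [`|w i|]. *)
Lemma sqr_total_weight_le : W ^+ 2 <= m%:R * \sum_(i < m) w i ^+ 2.
Proof.
have m0 : 0 < m%:R :> R by exact: lt_trans mr_gt1.
have : 0 <= \sum_(i < m) (`|w i| - W / m%:R) ^+ 2.
  by apply: sumr_ge0 => i _; exact: sqr_ge0.
have -> : \sum_(i < m) (`|w i| - W / m%:R) ^+ 2 =
    \sum_(i < m) w i ^+ 2 - W ^+ 2 / m%:R.
  under eq_bigr => i _.
    rewrite sqrrB real_normK ?num_real// -mulr_natl mulrA.
    over.
  rewrite big_split/= sumrB -mulr_suml -mulr_sumr -/(total_weight f j x) -/W.
  rewrite sumr_const card_ord -[X in _ + X]mulr_natl.
  by field; rewrite gt_eqF.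
by rewrite subr_ge0 ler_pdivrMr// mulrC.
Qed.

Lemma exists_weight : exists i, w i != 0.
Proof.
apply/existsP; apply: contraTT W0 => /existsPn w0.
rewrite -leNgt /W /total_weight big1// => i _.
by have := w0 i; rewrite negbK -/w => /eqP ->; rewrite normr0.
Qed.

(** [ln m - ln (m - 1) <= 1 / (m - 1) <= 1 / sqrt (m - 1)], whereas [epsilon]
    is at least twice the latter. *)
Lemma ln_ratio_lt_epsilon : (ln m%:R - ln (m%:R - 1)) / 2 < epsilon R m.
Proof.
have q0 : 0 < Num.sqrt (m%:R - 1 : R) by rewrite sqrtr_gt0.
have m2 : 1 <= m%:R - 1 :> R by rewrite lerBrDr (_ : 1 + 1 = 2%:R)// ler_nat.
have q1 : 1 <= Num.sqrt (m%:R - 1 : R).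
  by rewrite -[leLHS]sqrtr1 ler_wsqrtr.
have lnm : 0 <= ln m%:R :> R by rewrite ln_ge0// ltW.
have h1 : ln m%:R - ln (m%:R - 1) <= (Num.sqrt (m%:R - 1))^-1 :> R.
  rewrite -ln_div ?posrE//; last exact: lt_trans mr_gt1.
  have -> : m%:R / (m%:R - 1) = 1 + (m%:R - 1)^-1 :> R by field; rewrite gt_eqF.
  apply: (@le_trans _ _ (m%:R - 1)^-1).
    by apply: ln_1Dx_le; rewrite invr_ge0 ltW.
  rewrite lef_pV2 ?posrE// -[leRHS](@sqr_sqrtr _ (m%:R - 1)) ?(ltW mB1)//.
  by rewrite expr2 ler_peMl// ltW.
rewrite /epsilon ltr_pdivlMr//.
have : (ln m%:R - ln (m%:R - 1)) * Num.sqrt (m%:R - 1) <= 1 :> R.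
  by rewrite -ler_pdivlMr// div1r.
lra.
Qed.

Lemma log_lower_bound :
  - (ln (m%:R - 1) / 2) - ln 3 / 2 - (1 + epsilon R m) <
  2^-1 * ln ((\sum_(i < m) w i ^+ 2) / 3) - 1 - ln W.
Proof.
have m0 : 0 < m%:R :> R by exact: lt_trans mr_gt1.
have h := ln_ratio_lt_epsilon.
have W2 : 0 < W ^+ 2 by rewrite exprn_gt0.
have V0 : 0 < \sum_(i < m) w i ^+ 2.
  by have := lt_le_trans W2 sqr_total_weight_le; rewrite pmulr_rgt0.
have : ln (W ^+ 2) <= ln (m%:R * \sum_(i < m) w i ^+ 2).
  by rewrite ler_ln ?posrE ?mulr_gt0// sqr_total_weight_le.
rewrite lnXn// lnM ?posrE// ln_div ?posrE// -(mulr_natl (ln W)).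
move: h; lra.
Qed.

Lemma mean_log_gt :
  - (ln (m%:R - 1) / 2) - ln 3 / 2 - (1 + epsilon R m) <
  fine (mean_log f j x) - ln W.
Proof.
have [i wi] := exists_weight.
have := mean_log_ge wi; rewrite -(fineK (mean_log_fin wi)) lee_fin.
have := log_lower_bound; rewrite -/w; lra.
Qed.

(** Jensen's inequality in the form of a tangent: with [c = W * expR L], where
    [L] is the lower bound of [mean_log_gt], [E ln |S| <= E|S| / c + ln c - 1]
    and [E ln |S| > ln c] force [E|S| > c]. *)
Lemma mean_linear_error_gt :
  expR (- (1 + epsilon R m)) / Num.sqrt (3 * (m%:R - 1)) <
  fine (mean_linear_error f j x) / W.
Proof.
pose L := - (ln (m%:R - 1) / 2) - ln 3 / 2 - (1 + epsilon R m).
have -> : expR (- (1 + epsilon R m)) / Num.sqrt (3 * (m%:R - 1)) = expR L.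
  have p : 0 < 3 * (m%:R - 1) :> R by rewrite mulr_gt0.
  rewrite -[Num.sqrt _](@lnK R) ?posrE ?sqrtr_gt0// -expRN -expRD; congr expR.
  have : ln (3 * (m%:R - 1)) = 2 * ln (Num.sqrt (3 * (m%:R - 1))) :> R.
    by rewrite (mulr_natl (ln _)) -lnXn ?sqrtr_gt0// sqr_sqrtr// ltW.
  by rewrite lnM ?posrE// /L; lra.
have c0 : 0 < W * expR L by rewrite mulr_gt0// expR_gt0.
rewrite ltr_pdivlMr// mulrC.
have [i wi] := exists_weight.
have mS := measurable_norm_linear_error f j x.
have iS := integrable_norm_linear_error f j x.
have fE := mean_linear_error_fin f j x.
set s := fine (mean_linear_error f j x).
have : (mean_log f j x <= (s / (W * expR L) + (ln (W * expR L) - 1))%:E)%E.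
  apply: (@le_trans _ _ (\int[unif_law m]_t
     ((W * expR L)^-1%:E * `|S t|%:E + (ln (W * expR L) - 1)%:E))%E).
    apply: integral_mono.
    - exact: measurableT_comp measurable_lne mS.
    - apply: emeasurable_funD => //; apply: measurable_funeM.
      exact/measurable_EFinP.
    - move=> t; rewrite -EFinM -EFinD (mulrC _ `|S t|).
      exact: lne_le_tangent.
  rewrite integralD//=; last 2 first.
  - exact: integrableZl.
  - exact: finite_measure_integrable_cst.
  rewrite integralZl// integral_cst// [X in (_ + _ * X)%E]probability_setT mule1.
  by rewrite -/(mean_linear_error f j x) -(fineK fE) -EFinM -EFinD lee_fin mulrC.
rewrite -(fineK (mean_log_fin wi)) lee_fin lnM ?posrE ?expR_gt0// expRK => h.
have := mean_log_gt; rewrite -/L => h2.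
have : 1 < s / (W * expR L) by lra.
by rewrite ltr_pdivlMr// mul1r.
Qed.

(** The tangent to the logarithm at [W / 2], which dominates [E|S|], gives a
    bound that also covers a mean logarithm equal to [-oo]. *)
Lemma SCLP_at_le (e : R) : 0 < e -> \forall delta \near 0^'+,
  (SCLP_at f j x delta <= (ln W / ln 2 - 1 + e)%:E)%E.
Proof.
move=> e0; have ln20 : 0 < ln 2 :> R by apply: ln_gt0; lra.
pose c := W / 2; have c0 : 0 < c by rewrite divr_gt0.
pose e' := e * c * ln 2; have e'0 : 0 < e' by rewrite !mulr_gt0.
near=> delta.
have delta0 : 0 < delta by near: delta; exact: nbhs_right_gt.
have H : forall t, `|ratio f j x delta t - (`|S t|)| <= e'.
  by near: delta; exact: ratio_approx.
have mlog : measurable_fun [set: m.-tuple RR] 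
    (fun t => lne (ratio f j x delta t)%:E * (ln 2)^-1%:E)%E.
  apply: emeasurable_funM => //; apply: (measurableT_comp measurable_lne).
  exact: measurable_ratio.
rewrite SCLP_atE ?(ltW delta0)//.
pose k := (c * ln 2)^-1; pose b := (e' / c + (ln c - 1)) / ln 2.
have iS := integrable_norm_linear_error f j x.
apply: (@le_trans _ _ (\int[unif_law m]_t (k%:E * `|S t|%:E + b%:E))%E).
  apply: integral_mono => //.
    by apply: emeasurable_funD => //; apply: measurable_funeM; exact: measurable_int iS.
  move=> t; rewrite -EFinM -EFinD.
  have r0 := @ratio_ge0 _ _ _ f j x delta t (ltW delta0).
  apply: (@le_trans _ _ ((ratio f j x delta t / c + (ln c - 1))%:E * (ln 2)^-1%:E)%E).
    by rewrite lee_wpmul2r ?lee_fin ?invr_ge0 ?(ltW ln20)// lne_le_tangent.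
  rewrite -EFinM lee_fin.
  have -> : k * `|S t| + b = ((`|S t| + e') / c + (ln c - 1)) / ln 2.
    by rewrite /k /b; field; rewrite !gt_eqF.
  rewrite ler_wpM2r ?invr_ge0 ?(ltW ln20)// lerD2r ler_wpM2r ?invr_ge0 ?(ltW c0)//.
  by move: (H t); rewrite ler_norml; lra.
rewrite integralD//=; last 2 first.
- exact: integrableZl.
- exact: finite_measure_integrable_cst.
rewrite integralZl// integral_cst// [X in (_ + _ * X <= _)%E]probability_setT mule1.
have sle := mean_linear_error_le f j x.
rewrite -/(mean_linear_error f j x) -(fineK (mean_linear_error_fin f j x)) in sle *.
rewrite -EFinM -EFinD lee_fin; rewrite lee_fin -/W -/c in sle.
have lnc : ln c = ln W - ln 2 by rewrite /c ln_div ?posrE//; lra.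
apply: (@le_trans _ _ (k * c + b)); first by rewrite lerD2r ler_wpM2l// invr_ge0 mulr_ge0// ltW.
rewrite /k /b lnc /e'.
rewrite [leLHS](_ : _ = ln W / ln 2 - 1 + e)//.
by field; rewrite !gt_eqF.
Unshelve. all: by end_near. Qed.

Lemma SCLP_le : cvg (SCLP_at f j x delta @[delta --> 0^'+]) ->
  (SCLP f j x <= (ln W / ln 2 - 1)%:E)%E.
Proof.
move=> cS; apply/lee_addgt0Pr => e e0; rewrite -EFinD.
by apply: lime_le => //; exact: SCLP_at_le.
Qed.

End FinalInequalities.

Theorem theorem2 (R : realType) (m n : nat) (hm : (1 < m)%N) (hn : (1 <= n)%N)
    (f : 'rV[R]_m -> 'rV[R]_n) (hf : forall y : 'rV[R]_m, differentiable f y)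
    (j : 'I_n) (x : 'rV[R]_m) (hfx : f x 0 j != 0)
    (hW : (0 < WCC f j x)%E) :
  [/\ cvg (WCC_at f j x delta @[delta --> 0^'+]),
      (* lower bound on the loss of precision: false for f merely
         differentiable, hence the continuity of the partial derivatives of
         the j-th component at the single point x *)
      (forall i : 'I_m, {for x, continuous (fun y => 'J f y i j)}) ->
        cvg (SCLP_at f j x delta @[delta --> 0^'+]) /\
        ((- (log2 (m%:R - 1) / 2) - log2 3 / 2
            - (1 + epsilon R m) * log2 (expR 1))%:E
           < SCLP f j x - elog2 (WCC f j x))%E,
      (* upper bound on the loss of precision *)
      cvg (SCLP_at f j x delta @[delta --> 0^'+]) ->
        (SCLP f j x - elog2 (WCC f j x) <= (-1)%:E)%E,
      cvg (SCC_at f j x delta @[delta --> 0^'+]) &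
      ((expR (- (1 + epsilon R m)) / Num.sqrt (3 * (m%:R - 1)))%:E
         < SCC f j x / WCC f j x)%E /\
      (SCC f j x / WCC f j x <= (1 / 2)%:E)%E].
Proof.
have WE := WCC_E hf hfx.
have W0 : 0 < total_weight f j x by rewrite WE lte_fin in hW.
have ln20 : 0 < ln 2 :> R by apply: ln_gt0; lra.
have elogW : elog2 (WCC f j x) = (ln (total_weight f j x) / ln 2)%:E.
  by rewrite WE /elog2 lne_EFin.
have fE := mean_linear_error_fin f j x.
have divE : (SCC f j x / WCC f j x =
    (fine (mean_linear_error f j x) / total_weight f j x)%:E)%E.
  by rewrite WE (SCC_E hf hfx) -[in LHS](fineK fE) inver gt_eqF// -EFinM.
split.
- by apply: cvgP; exact: cvg_WCC_at.
- move=> cJ; have [i wi] := exists_weight W0.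
  have cS := cvg_SCLP_at hf hfx wi (cJ i).
  split; first exact: cvgP cS.
  rewrite (SCLP_E hf hfx wi (cJ i)) elogW -EFinB lte_fin /log2 expRK.
  rewrite -mulrBl [ltLHS](_ : _ = (- (ln (m%:R - 1) / 2) - ln 3 / 2
    - (1 + epsilon R m)) / ln 2); last by field; rewrite gt_eqF.
  by rewrite ltr_pM2r ?invr_gt0//; exact: mean_log_gt.
- move=> cS; rewrite elogW leeBlDr//.
  apply: (le_trans (SCLP_le hf hfx W0 cS)).
  by rewrite -EFinD lee_fin addrC.
- by apply: cvgP; exact: cvg_SCC_at.
- rewrite divE lte_fin lee_fin; split; first exact: mean_linear_error_gt.
  rewrite ler_pdivrMr// mul1r mulrC.
  by have := mean_linear_error_le f j x; rewrite -(fineK fE) lee_fin.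
Qed.
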